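(* Let $1\le p_1\le p_2<2$ and $\gamma\ge1$. There exists $\delta=\delta(\gamma,p_2)>0$ such that for every weight $w$ with $w-1\in L^{p_1}(\mathbb{R})+L^{p_2}(\mathbb{R})$ and $[w]_{A_2(\mathbb{R})}\le\gamma$, $$P(r,\lambda;w)-e^{i\lambda r}\in L^p_w(\mathbb{R})\qquad\text{for all } r>0 \text{ and all } p\in[2-\delta,\infty).$$
   Context: A weight is a measurable function $w\ge0$ on $\mathbb{R}$. $L^p_w(\mathbb{R})$ denotes $L^p(\mathbb{R},w(\lambda)\,d\lambda)$, in the variable $\lambda$. $[w]_{A_2(\mathbb{R})}=\sup_I\langle w\rangle_I\langle w^{-1}\rangle_I$, where $I$ ranges over finite intervals and $\langle f\rangle_I=\frac1{|I|}\int_If$. Krein system solution $P(r,\lambda;w)$: let $w\ge 0$ with $w-1\in L^1(\mathbb{R})+L^2(\mathbb{R})$ (this contains $L^{p_1}+L^{p_2}$ for $p_1,p_2\in[1,2]$). Put $H(x)=\frac1{2\pi}\int_{\mathbb{R}}(w(\lambda)-1)e^{i\lambda x}\,d\lambda$ (Fourier transform in the $L^1+L^2$ sense), so $H\in L^2_{loc}(\mathbb{R})$. For $r>0$ define $\mathcal{H}_r$ on $L^2([0,r])$ by $\mathcal{H}_rf(x)=\int_0^rH(x-y)f(y)\,dy$; then $I+\mathcal{H}_r>0$ is boundedly invertible, and $I-(I+\mathcal{H}_r)^{-1}$ is an integral operator with kernel $\Gamma_r(s,t)$, $0\le s,t\le r$, satisfying $\Gamma_r(s,t)=\overline{\Gamma_r(t,s)}=\Gamma_r(r-t,r-s)$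 and $\Gamma_r(\cdot,0)=(I+\mathcal{H}_r)^{-1}(H|_{[0,r]})$. Then, for $r>0$, $P(r,\lambda;w)=e^{i\lambda r}-\int_0^r\Gamma_r(r,t)e^{i\lambda t}\,dt$ with $\Gamma_r(r,t)=\Gamma_r(r-t,0)$. *)

(* Defs.v *)
From HB Require Import structures.
From mathcomp Require Import all_boot all_order all_algebra.
From mathcomp Require Import complex.
From mathcomp Require Import all_classical all_reals all_analysis.

Set Implicit Arguments.
Unset Strict Implicit.
Unset Printing Implicit Defensive.

Import Order.TTheory GRing.Theory Num.Theory.
Import numFieldNormedType.Exports.

Local Open Scope classical_set_scope.
Local Open Scope ring_scope.

Section Defs.
Context {R : realType}.
Local Notation mu := (@lebesgue_measure R).
Implicit Types (w u f : R -> R) (F G : R -> R[i]) (A : set R).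

(* exp (i t) *)
Definition expi (t : R) : R[i] := Complex (cos t) (sin t).

Definition Cmeasurable A F : Prop :=
  measurable_fun A (fun x => complex.Re (F x)) /\
  measurable_fun A (fun x => complex.Im (F x)).

Definition Cintegral A F : R[i] :=
  Complex (\int[mu]_(x in A) complex.Re (F x))%R
          (\int[mu]_(x in A) complex.Im (F x))%R.

Definition weight w : Prop := measurable_fun setT w /\ forall x, 0 <= w x.

(* F belongs to L^p (R, w dx); Normc.normc is the R-valued modulus. *)
Definition in_Lp_weighted (p : R) w F : Prop :=
  Cmeasurable setT F /\
  (\int[mu]_x ((Normc.normc (F x) `^ p * w x)%:E) < +oo)%E.

(* A real-valued u is in L^p1 + L^p2 with complex summands iff it is with
   real ones (take real parts). *)
Definition in_Lp_sum (p1 p2 : R) u : Prop :=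
  exists f1 f2, [/\ f1 \in Lfun mu p1%:E, f2 \in Lfun mu p2%:E
    & forall x, u x = f1 x + f2 x].

(* <g>_[a, b] *)
Definition average (a b : R) (g : R -> \bar R) : \bar R :=
  (((b - a)^-1)%:E * \int[mu]_(x in `[a, b]) g x)%E.

(* The inverse of w is taken in \bar R, where 0^-1 = +oo. *)
Definition A2_characteristic w : \bar R :=
  ereal_sup [set y | exists a b : R, a < b /\
    y = (average a b (fun x => (w x)%:E) *
         average a b (fun x => (w x)%:E^-1))%E].

(* int_A f(l) exp (i l x) dl *)
Definition fourier_on A f (x : R) : R[i] :=
  Cintegral A (fun l => Complex (f l) 0 * expi (l * x)).

(* F is the L^2-limit of the transforms of the truncations of f. *)
Definition is_fourier_L2 f F : Prop :=
  Cmeasurable setT F /\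
  (fun n : nat => \int[mu]_x
     ((Normc.normc (fourier_on `[- n%:R, n%:R] f x - F x) ^+ 2)%:E))%E
    @ \oo --> 0%E.

Definition is_fourier_L1L2 u F : Prop :=
  exists f1 f2 F2, [/\ f1 \in Lfun mu 1%:E, f2 \in Lfun mu 2%:E,
    forall x, u x = f1 x + f2 x,
    is_fourier_L2 f2 F2
    & forall x, F x = fourier_on setT f1 x + F2 x].

(* The Fourier transform in the L^1 + L^2 sense is determined up to a null
   set; xget picks a representative, as it does for krein_Gamma0 below. The
   value of krein_P does not depend on these choices. *)
Definition krein_H w : R -> R[i] :=
  fun x => Complex (2 * pi)^-1 0 *
    xget (cst 0) [set F | is_fourier_L1L2 (fun l => w l - 1) F] x.

(* f |-> int_0^r H(. - y) f(y) dy on L^2([0, r]), with H = krein_H w *)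
Definition krein_op w (r : R) G (x : R) : R[i] :=
  Cintegral `[0, r] (fun y => krein_H w (x - y) * G y).

Definition in_L2_segment (r : R) G : Prop :=
  Cmeasurable `[0, r] G /\
  (\int[mu]_(x in `[0%R, r]) ((Normc.normc (G x) ^+ 2)%:E) < +oo)%E.

(* G = (I + krein_op w r)^-1 K in L^2([0, r]) *)
Definition is_krein_preimage w (r : R) (K G : R -> R[i]) : Prop :=
  in_L2_segment r G /\
  {ae mu, forall x, x \in `[0, r] -> G x + krein_op w r G x = K x}.

(* Gamma_r(s, 0) = ((I + krein_op w r)^-1 (H restricted to [0, r])) (s) *)
Definition krein_Gamma0 w (r : R) : R -> R[i] :=
  xget (cst 0) [set G | is_krein_preimage w r (krein_H w) G].

(* Gamma_r(r, t) = Gamma_r(r - t, 0) *)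
Definition krein_P (r l : R) w : R[i] :=
  expi (l * r) -
  Cintegral `[0, r] (fun t => krein_Gamma0 w r (r - t) * expi (l * t)).

End Defs.

(* Main.v *)
(* Write [u = w - 1] and let [ghat] be the Fourier transform of [Gamma_r (., 0)],
   which is supported in [0, r], so that |P(r, l; w) - exp (i l r)| = |ghat l|
   and [ghat] is bounded. The equation Gamma = H - H * Gamma on [0, r] reads, on
   the Fourier side,
     ghat (l) = (2 pi)^-1 int u(x) (1 - ghat (x)) D(x - l) dx,
   where D(x) = int_0^r exp (i x s) ds is at most a multiple of (1 + |x|)^-1.
   For general u this is obtained from truncations of u to [-n, n], which give
   kernels converging to H in L^1 (-r, r). Hence |ghat| is dominated by
   |u| * (1 + |.|)^-1, and a Young-type inequality puts it in L^q for every
   q > p2, by the slack between p2 and q: the kernel is in L^s for all s > 1.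
   Since w <= 3 + |f1|^p1 + |f2|^p2, where w - 1 = f1 + f2, and [ghat] is
   bounded, unweighted integrability of |ghat|^q gives the weighted one. *)
From HB Require Import structures.
Require Import Defs.
From mathcomp Require Import all_boot all_order all_algebra.
From mathcomp Require Import complex ring lra.
From mathcomp Require Import all_classical all_reals all_analysis.
From mathcomp Require Import measurable_realfun.
Import Order.TTheory GRing.Theory Num.Theory.
Import numFieldNormedType.Exports.
Local Open Scope classical_set_scope.
Local Open Scope ring_scope.
Set Implicit Arguments.
Unset Strict Implicit.
Unset Printing Implicit Defensive.

(** Two features make the passage through truncations harmless. The equation on [0, r] sees H only
    on [-r, r], so an L^1 (-r, r) error in H moves the transformed equation by an amount uniform in
    [l]; and the bound for a truncation involves only |u|, not the order of truncation. The unknown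
    also stands on the right of that formula, but it is not solved for: Gamma is square integrable
    on a bounded segment, hence integrable, so 1 - ghat is bounded by a constant depending on [r].
    The Young-type inequality is used pointwise: a convolution is dominated by the 1/p-th power of
    an explicit integrable function. Integrability of |ghat|^p, with or without the weight, is then
    a matter of pointwise majorants and no L^p norm is manipulated. *)

Local Notation nc := (@Normc.normc _).

(** * Complex-valued integrals *)

Section ComplexModulus.
Context {R : realType}.
Implicit Types z : R[i].

Lemma normc_ge0 z : 0 <= nc z.
Proof. by case: z => a b; exact: sqrtr_ge0. Qed.

Lemma normr_Re_le z : `|complex.Re z| <= nc z.
Proof.
by case: z => a b /=; rewrite -sqrtr_sqr ler_wsqrtr// lerDl sqr_ge0.
Qed.

Lemma normr_Im_le z : `|complex.Im z| <= nc z.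
Proof.
by case: z => a b /=; rewrite -sqrtr_sqr ler_wsqrtr// lerDr sqr_ge0.
Qed.

Lemma normc_le_ReIm z : nc z <= `|complex.Re z| + `|complex.Im z|.
Proof.
case: z => a b /=.
rewrite -[leRHS](@ger0_norm _ (`|a| + `|b|)) ?addr_ge0// -sqrtr_sqr.
rewrite ler_wsqrtr// sqrrD !real_normK ?num_real//.
by rewrite -addrA lerD2l lerDr mulrn_wge0// mulr_ge0.
Qed.

Lemma normc_expi (t : R) : nc (expi t) = 1.
Proof. by rewrite /= cos2Dsin2 sqrtr1. Qed.

Lemma expiD (s t : R) : expi (s + t) = expi s * expi t.
Proof. by rewrite /expi cosD sinD; congr Complex; rewrite addrC. Qed.

Lemma expi0 : expi (0 : R) = 1.
Proof. by rewrite /expi cos0 sin0. Qed.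

Lemma normc_real (a : R) : nc (Complex a 0) = `|a|.
Proof. by rewrite /= expr0n addr0 sqrtr_sqr. Qed.

Lemma normcN z : nc (- z) = nc z.
Proof. exact: normcN. Qed.

Lemma normcD_le z1 z2 : nc (z1 + z2) <= nc z1 + nc z2.
Proof. exact: le_normcD. Qed.

Lemma ReM z1 z2 : complex.Re (z1 * z2) =
  complex.Re z1 * complex.Re z2 - complex.Im z1 * complex.Im z2.
Proof. by case: z1 => a b; case: z2. Qed.

Lemma ImM z1 z2 : complex.Im (z1 * z2) =
  complex.Re z1 * complex.Im z2 + complex.Im z1 * complex.Re z2.
Proof. by case: z1 => a b; case: z2. Qed.

Lemma complexE z : z = Complex (complex.Re z) (complex.Im z).
Proof. by case: z. Qed.

End ComplexModulus.

Section ComplexIntegral.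
Context d (T : measurableType d) {R : realType}.
Variable m : {measure set T -> \bar R}.
Implicit Types F K L : T -> R[i].

Definition cmeasurable F :=
  measurable_fun setT (fun x => complex.Re (F x)) /\
  measurable_fun setT (fun x => complex.Im (F x)).

Definition cintegrable F :=
  m.-integrable setT (fun x => (complex.Re (F x))%:E) /\
  m.-integrable setT (fun x => (complex.Im (F x))%:E).

Definition cint F : R[i] :=
  Complex (\int[m]_x complex.Re (F x))%R (\int[m]_x complex.Im (F x))%R.

Lemma cmeasurable_normc F : cmeasurable F ->
  measurable_fun setT (fun x => nc (F x)).
Proof.
case=> mr mi.
rewrite (_ : (fun x => _) =
  (fun x => Num.sqrt (complex.Re (F x) ^+ 2 + complex.Im (F x) ^+ 2))).
  apply: (measurableT_comp
    (continuous_measurable_fun (@sqrt_continuous R))).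
  by apply: measurable_funD; exact: measurable_funX.
by apply/funext => x; case: (F x).
Qed.

Lemma cmeasurableD F K : cmeasurable F -> cmeasurable K ->
  cmeasurable (fun x => F x + K x).
Proof.
move=> [a b] [c e]; split.
  rewrite (_ : (fun x => _) = (fun x => complex.Re (F x) + complex.Re (K x))).
    exact: measurable_funD.
  by apply/funext => x; case: (F x); case: (K x).
rewrite (_ : (fun x => _) = (fun x => complex.Im (F x) + complex.Im (K x))).
  exact: measurable_funD.
by apply/funext => x; case: (F x); case: (K x).
Qed.

Lemma cmeasurableN F : cmeasurable F -> cmeasurable (fun x => - F x).
Proof.
move=> [a b]; split.
  rewrite (_ : (fun x => _) = (fun x => - complex.Re (F x))).
    exact: measurableT_comp.
  by apply/funext => x; case: (F x).
rewrite (_ : (fun x => _) = (fun x => - complex.Im (F x))).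
  exact: measurableT_comp.
by apply/funext => x; case: (F x).
Qed.

Lemma cmeasurableB F K : cmeasurable F -> cmeasurable K ->
  cmeasurable (fun x => F x - K x).
Proof. by move=> mF mK; apply: cmeasurableD => //; exact: cmeasurableN. Qed.

Lemma cmeasurableM F K : cmeasurable F -> cmeasurable K ->
  cmeasurable (fun x => F x * K x).
Proof.
move=> [a b] [c e]; split.
  under eq_fun do rewrite ReM.
  by apply: measurable_funB; exact: measurable_funM.
under eq_fun do rewrite ImM.
by apply: measurable_funD; exact: measurable_funM.
Qed.

Lemma cmeasurable_cst (z : R[i]) : cmeasurable (fun=> z).
Proof. by split; exact: measurable_cst. Qed.

Lemma cmeasurable_expi (f : T -> R) : measurable_fun setT f ->
  cmeasurable (fun x => expi (f x)).
Proof.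
move=> mf; split => /=; apply: measurableT_comp => //;
  apply: continuous_measurable_fun;
  [exact: continuous_cos|exact: continuous_sin].
Qed.

Lemma cintegrable_cmeasurable F : cintegrable F -> cmeasurable F.
Proof.
by move=> [/measurable_int/measurable_EFinP a /measurable_int/measurable_EFinP].
Qed.

Lemma cintegrableP F : cintegrable F <->
  cmeasurable F /\ (\int[m]_x (nc (F x))%:E < +oo)%E.
Proof.
split=> [iF|[[mr mi] iF]].
  split; first exact: cintegrable_cmeasurable.
  have mF := cmeasurable_normc (cintegrable_cmeasurable iF).
  have [/integrable_norm ir /integrable_norm ii] := iF.
  have := integrable_lty measurableT (integrableD measurableT ir ii).
  apply: le_lt_trans; apply: ge0_le_integral => //=.
  - by move=> x _; rewrite lee_fin normc_ge0.
  - exact/measurable_EFinP.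
  - have [/measurable_int + /measurable_int +] := conj ir ii.
    exact: emeasurable_funD.
  - by move=> x _; rewrite lee_fin normc_le_ReIm.
split; apply/integrableP; split; try exact/measurable_EFinP.
  apply: le_lt_trans iF; apply: ge0_le_integral => //=.
  - by apply/measurable_EFinP; exact: measurableT_comp.
  - by apply/measurable_EFinP; exact: cmeasurable_normc.
  - by move=> x _; rewrite lee_fin normr_Re_le.
apply: le_lt_trans iF; apply: ge0_le_integral => //=.
- by apply/measurable_EFinP; exact: measurableT_comp.
- by apply/measurable_EFinP; exact: cmeasurable_normc.
- by move=> x _; rewrite lee_fin normr_Im_le.
Qed.

Lemma le_cintegrable F (g : T -> R) : cmeasurable F ->
  m.-integrable setT (EFin \o g) -> (forall x, nc (F x) <= g x) ->
  cintegrable F.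
Proof.
move=> mF ig Fg; apply/cintegrableP; split => //.
apply: le_lt_trans (integrable_lty measurableT ig).
apply: ge0_le_integral => //=.
- by move=> x _; rewrite lee_fin normc_ge0.
- by apply/measurable_EFinP; exact: cmeasurable_normc.
- exact: measurable_int ig.
- by move=> x _; rewrite lee_fin.
Qed.

Lemma cintegrable_normc F : cintegrable F ->
  m.-integrable setT (fun x => (nc (F x))%:E).
Proof.
move=> /cintegrableP[mF iF]; apply/integrableP; split.
  by apply/measurable_EFinP; exact: cmeasurable_normc.
by under eq_integral do rewrite gee0_abs ?lee_fin ?normc_ge0//.
Qed.

Lemma cintegrable_le F K : cmeasurable F -> cintegrable K ->
  (forall x, nc (F x) <= nc (K x)) -> cintegrable F.
Proof. by move=> mF /cintegrable_normc iK; exact: le_cintegrable. Qed.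

Lemma cintegrableD F K : cintegrable F -> cintegrable K ->
  cintegrable (fun x => F x + K x).
Proof.
move=> iF iK; apply: (@le_cintegrable _ (fun x => nc (F x) + nc (K x))).
- by apply: cmeasurableD; exact: cintegrable_cmeasurable.
- exact: (integrableD measurableT (cintegrable_normc iF) (cintegrable_normc iK)).
- by move=> x; exact: normcD_le.
Qed.

Lemma cintegrableN F : cintegrable F -> cintegrable (fun x => - F x).
Proof.
move=> iF; apply: (cintegrable_le _ iF).
  by apply: cmeasurableN; exact: cintegrable_cmeasurable.
by move=> x; rewrite normcN.
Qed.

Lemma cintegrableB F K : cintegrable F -> cintegrable K ->
  cintegrable (fun x => F x - K x).
Proof. by move=> iF iK; apply: cintegrableD => //; exact: cintegrableN. Qed.

Lemma cintegrableM F K (c : R) : cintegrable F -> cmeasurable K ->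
  (forall x, nc (K x) <= c) -> cintegrable (fun x => F x * K x).
Proof.
move=> iF mK Kc; apply: (@le_cintegrable _ (fun x => c * nc (F x))).
- by apply: cmeasurableM => //; exact: cintegrable_cmeasurable.
- exact: (integrableZl measurableT c (cintegrable_normc iF)).
- by move=> x; rewrite Normc.normcM mulrC ler_wpM2r// normc_ge0.
Qed.

Lemma cintegrableZl (z : R[i]) F : cintegrable F ->
  cintegrable (fun x => z * F x).
Proof.
move=> iF; under eq_fun do rewrite mulrC.
by apply: (@cintegrableM _ _ (nc z)) => //; exact: cmeasurable_cst.
Qed.

Lemma cintD F K : cintegrable F -> cintegrable K ->
  cint (fun x => F x + K x) = cint F + cint K.
Proof.
move=> [a b] [c e]; rewrite /cint.
rewrite [RHS](_ : _ = Complex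
   ((\int[m]_x complex.Re (F x)) + (\int[m]_x complex.Re (K x)))%R
   ((\int[m]_x complex.Im (F x)) + (\int[m]_x complex.Im (K x)))%R)//.
rewrite -!RintegralD//; congr Complex; apply: eq_Rintegral => x _;
  by case: (F x); case: (K x).
Qed.

Lemma cintZl (z : R[i]) F : cintegrable F ->
  cint (fun x => z * F x) = z * cint F.
Proof.
move=> [a b]; rewrite /cint [RHS]complexE ReM ImM /=.
rewrite -!RintegralZl//.
have aux (k : R) (f : T -> R) : m.-integrable setT (EFin \o f) ->
    m.-integrable setT (EFin \o (fun x => k * f x)).
  by move=> /(integrableZl measurableT k).
rewrite -RintegralB//; [|exact: aux|exact: aux].
rewrite -RintegralD//; [|exact: aux|exact: aux].
by congr Complex; apply: eq_Rintegral => x _; rewrite (ReM, ImM).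
Qed.

Lemma cintZr (z : R[i]) F : cintegrable F ->
  cint (fun x => F x * z) = cint F * z.
Proof.
by move=> iF; rewrite mulrC -cintZl//; congr cint; apply/funext => x; rewrite mulrC.
Qed.

Lemma cintN F : cintegrable F -> cint (fun x => - F x) = - cint F.
Proof.
move=> iF; rewrite -[RHS]mulN1r -cintZl//.
by congr cint; apply/funext => x; rewrite mulN1r.
Qed.

Lemma cintB F K : cintegrable F -> cintegrable K ->
  cint (fun x => F x - K x) = cint F - cint K.
Proof.
by move=> iF iK; rewrite cintD ?cintN//; exact: cintegrableN.
Qed.

(* The factor 2 comes from bounding real and imaginary parts separately. *)
Lemma normc_cint_le F : cmeasurable F ->
  ((nc (cint F))%:E <= 2%:E * \int[m]_x (nc (F x))%:E)%E.
Proof.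
move=> mF.
have [iF|] := pselect ((\int[m]_x (nc (F x))%:E < +oo)%E); last first.
  move/negP; rewrite -leNgt leye_eq => /eqP ->.
  by rewrite mulry gtr0_sg// mul1e leey.
have cF : cintegrable F by apply/cintegrableP.
have nF := cintegrable_normc cF.
have [ir ii] := cF.
rewrite -(fineK (integrable_fin_num measurableT nF)) -EFinM lee_fin.
apply: (le_trans (normc_le_ReIm _)); rewrite mulrDl mul1r lerD//=.
  apply: (le_trans (le_normr_Rintegral measurableT ir)).
  apply: le_Rintegral => //; first exact: (integrable_norm ir).
  by move=> x _; exact: normr_Re_le.
apply: (le_trans (le_normr_Rintegral measurableT ii)).
apply: le_Rintegral => //; first exact: (integrable_norm ii).
by move=> x _; exact: normr_Im_le.
Qed.

Lemma ae_mono (P Q : T -> Prop) : (forall x, P x -> Q x) ->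
  {ae m, forall x, P x} -> {ae m, forall x, Q x}.
Proof. by move=> PQ; apply: filterS. Qed.

Lemma ae_mono2 (P Q S : T -> Prop) : (forall x, P x -> Q x -> S x) ->
  {ae m, forall x, P x} -> {ae m, forall x, Q x} -> {ae m, forall x, S x}.
Proof. by move=> PQS; apply: filterS2. Qed.

Lemma ae_eq_cint F K : cmeasurable F -> cmeasurable K ->
  {ae m, forall x, F x = K x} -> cint F = cint K.
Proof.
move=> [mrF miF] [mrK miK] FK; rewrite /cint /Rintegral.
congr (Complex (fine _) (fine _)); apply: ae_eq_integral => //;
  try exact/measurable_EFinP.
- by apply: filterS FK => x /= ->.
- by apply: filterS FK => x /= ->.
Qed.

End ComplexIntegral.

(** * Fubini and Tonelli for complex-valued integrands *)

Section Fubini_complex.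
Context d1 d2 (T1 : measurableType d1) (T2 : measurableType d2) {R : realType}.
Variable m1 : {sigma_finite_measure set T1 -> \bar R}.
Variable m2 : {sigma_finite_measure set T2 -> \bar R}.

(** No integrability is assumed: Tonelli makes the integrals of the positive and negative parts
    measurable, and composing with [fine] keeps this, whatever value it gives to divergent
    slices. *)
Lemma measurable_Rintegral_param (f : T1 * T2 -> R) : measurable_fun setT f ->
  measurable_fun setT (fun x => (\int[m2]_y f (x, y))%R).
Proof.
move=> mf; rewrite /Rintegral.
apply: (@measurableT_comp _ _ _ _ _ _ fine) => //.
have mfE : measurable_fun setT (EFin \o f) by exact/measurable_EFinP.
have -> : (fun x => \int[m2]_y (f (x, y))%:E)%E = (fun x =>
  \int[m2]_y (EFin \o f)^\+%E (x, y) - \int[m2]_y (EFin \o f)^\-%E (x, y))%E.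
  apply/funext => x; rewrite [LHS]integralE.
  by congr (_ - _)%E; apply: eq_integral => y _; rewrite !unlock.
apply: emeasurable_funB.
- apply: (measurable_fun_fubini_tonelli_F (EFin \o f)^\+%E) => //.
  exact: measurable_funepos.
- apply: (measurable_fun_fubini_tonelli_F (EFin \o f)^\-%E) => //.
  exact: measurable_funeneg.
Qed.

Lemma cmeasurable_cint_param (F : T1 * T2 -> R[i]) : cmeasurable F ->
  cmeasurable (fun x => cint m2 (fun y => F (x, y))).
Proof. by move=> [a b]; split; [exact: (measurable_Rintegral_param a)|exact: (measurable_Rintegral_param b)]. Qed.

Lemma integrable_Rintegral_param (f : T1 * T2 -> R) :
  (m1 \x m2)%E.-integrable setT (EFin \o f) ->
  m1.-integrable setT (fun x => (\int[m2]_y f (x, y))%R%:E).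
Proof.
move=> /[dup] iF /measurable_int/measurable_EFinP mf.
have := integrable_fubini_F iF.
apply: le_integrable => //.
- by apply/measurable_EFinP; exact: measurable_Rintegral_param.
(* Where the slice integral is infinite, [fine] returns 0 and the bound is trivial. *)
- move=> x _; rewrite /fubini_F /Rintegral /=.
  by case: (integral _ _ _) => //=; rewrite ?normr0 leey.
Qed.

Lemma Rintegral_prod1 (f : T1 * T2 -> R) :
  (m1 \x m2)%E.-integrable setT (EFin \o f) ->
  (\int[m1]_x \int[m2]_y f (x, y))%R = (\int[(m1 \x m2)%E]_z f z)%R.
Proof.
move=> /[dup] iF /measurable_int/measurable_EFinP mf.
rewrite /Rintegral -integral12_prod_meas1//; congr fine.
apply: ae_eq_integral => //.
- by apply/measurable_EFinP; exact: measurable_Rintegral_param.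
- exact: (measurable_fubini_F iF).
(* Almost every slice integral is finite, and there [fine] loses nothing. *)
- have := integrable_ae measurableT (integrable_fubini_F iF).
  by apply: filterS => x /(_ I) xfin _; rewrite /= fineK.
Qed.

Lemma Rintegral_prod2 (f : T1 * T2 -> R) :
  (m1 \x m2)%E.-integrable setT (EFin \o f) ->
  (\int[m2]_y \int[m1]_x f (x, y))%R = (\int[(m1 \x m2)%E]_z f z)%R.
Proof.
move=> /[dup] iF /measurable_int/measurable_EFinP mf.
rewrite /Rintegral -integral21_prod_meas1//; congr fine.
apply: ae_eq_integral => //.
- apply/measurable_EFinP.
  have mg := @measurable_fubini_G _ _ _ _ _ m1 m2 _ iF.
  by apply: (@measurableT_comp _ _ _ _ _ _ fine _ _ _ mg).
- exact: (measurable_fubini_G iF).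
- have iG : m2.-integrable setT (fubini_G m1 (EFin \o f)).
    apply/integrableP; split; first exact: (measurable_fubini_G iF).
    have mfE : measurable_fun setT (EFin \o f) by exact/measurable_EFinP.
    apply: le_lt_trans ((integrable21ltyP m1 m2 mfE).1 iF).
    apply: ge0_le_integral => //.
    + by apply: measurableT_comp => //; exact: (measurable_fubini_G iF).
    + apply: (measurable_fun_fubini_tonelli_G (abse \o (EFin \o f))) => //=.
      exact: measurableT_comp.
    + move=> y _; apply: le_abse_integral => //.
      by apply: (measurableT_comp mfE); exact: measurable_pair2.
  have := integrable_ae measurableT iG.
  by apply: filterS => x /(_ I) xfin _; rewrite /= fineK.
Qed.

Lemma cint_prod2 (F : T1 * T2 -> R[i]) : cintegrable (m1 \x m2)%E F ->
  cint m2 (fun y => cint m1 (fun x => F (x, y))) = cint (m1 \x m2)%E F.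
Proof.
by move=> [ir ii]; congr Complex;
  [exact: (Rintegral_prod2 ir)|exact: (Rintegral_prod2 ii)].
Qed.

Lemma cint_prod1 (F : T1 * T2 -> R[i]) : cintegrable (m1 \x m2)%E F ->
  cint m1 (fun x => cint m2 (fun y => F (x, y))) = cint (m1 \x m2)%E F.
Proof.
by move=> [ir ii]; congr Complex;
  [exact: (Rintegral_prod1 ir)|exact: (Rintegral_prod1 ii)].
Qed.

Lemma cintegrable_param (F : T1 * T2 -> R[i]) : cintegrable (m1 \x m2)%E F ->
  cintegrable m1 (fun x => cint m2 (fun y => F (x, y))).
Proof.
by move=> [ir ii]; split;
  [exact: (integrable_Rintegral_param ir)|exact: (integrable_Rintegral_param ii)].
Qed.

Lemma ae_cintegrable (F : T1 * T2 -> R[i]) : cintegrable (m1 \x m2)%E F ->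
  {ae m1, forall x, cintegrable m2 (fun y => F (x, y))}.
Proof.
move=> [/ae_integrable1 ir /ae_integrable1 ii].
by apply: filterS2 ir ii => x.
Qed.

Lemma cintegrable_prod (F : T1 * T2 -> R[i]) (K : T1 -> R[i]) (L : T2 -> R[i]) :
  cmeasurable F -> cintegrable m1 K -> cintegrable m2 L ->
  (forall x y, nc (F (x, y)) <= nc (K x) * nc (L y)) ->
  cintegrable (m1 \x m2)%E F.
Proof.
move=> mF /cintegrable_normc iK /cintegrable_normc iL FKL.
apply/cintegrableP; split => //.
have mn := cmeasurable_normc mF.
rewrite (fubini_tonelli1 (fun z => (nc (F z))%:E))//=; first last.
- by move=> x; rewrite lee_fin normc_ge0.
- exact/measurable_EFinP.
rewrite /fubini_F.
apply: (@le_lt_trans _ _ (\int[m1]_x ((nc (K x))%:E * \int[m2]_y (nc (L y))%:E))%E).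
  apply: ge0_le_integral => //.
  - by move=> x _; apply: integral_ge0 => y _; rewrite lee_fin normc_ge0.
  - apply: (measurable_fun_fubini_tonelli_F (fun z => (nc (F z))%:E)) => //.
    + exact/measurable_EFinP.
    + by move=> z; rewrite lee_fin normc_ge0.
  - apply: emeasurable_funM => //; exact: measurable_int iK.
  - move=> x _; rewrite -ge0_integralZl//; last 3 first.
    + exact: measurable_int iL.
    + by move=> y _; rewrite lee_fin normc_ge0.
    + by rewrite lee_fin normc_ge0.
    apply: ge0_le_integral => //.
    + by move=> y _; rewrite lee_fin normc_ge0.
    + apply/measurable_EFinP; apply: (measurableT_comp mn).
      exact: measurable_pair1.
    + apply: emeasurable_funM => //; exact: measurable_int iL.
    + by move=> y _; rewrite -EFinM lee_fin.
rewrite ge0_integralZr//; last 3 first.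
- exact: measurable_int iK.
- by move=> y _; rewrite lee_fin normc_ge0.
- by apply: integral_ge0 => y _; rewrite lee_fin normc_ge0.
apply: lte_mul_pinfty.
- by apply: integral_ge0 => y _; rewrite lee_fin normc_ge0.
- exact: integrable_fin_num.
- exact: integrable_lty.
Qed.

End Fubini_complex.

(** * Convolutions on the real line *)

Section Lebesgue_reflection.
Context {R : realType}.
Local Notation mu := (@lebesgue_measure R).
Local Notation cmeasurableR := (@cmeasurable _ (measurableTypeR R) R).

(** Reflections also yield translations, since x - c = - c - (0 - x); a single change of variables
    thus serves convolutions and the substitution of r - t for t in [krein_P]. *)
Definition reflection (c : R) (x : measurableTypeR R) : measurableTypeR R :=
  c - x.

Lemma measurable_reflection (c : R) : measurable_fun setT (reflection c).
Proof. by apply: measurable_funB => //; exact: measurable_id. Qed.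

HB.instance Definition _ (c : R) :=
  isMeasurableFun.Build _ _ _ _ (reflection c) (measurable_reflection c).

Lemma lebesgue_measure_reflection (c : R) (A : set R) : measurable A ->
  pushforward mu (reflection c) A = mu A.
Proof.
move=> mA; apply/esym/lebesgue_measure_unique => //= _ [[a b]] _ <-.
(* The preimage of a generating half-open interval is half-open at the other end, with the same
   length. *)
rewrite /pushforward [X in _ = _ X](_ : _ = `[c - b, c - a[%classic).
  rewrite !lebesgue_measure_itv/= !lte_fin ltrD2l ltrN2 -!EFinD.
  by have -> : c - a - (c - b) = b - a by lra.
by apply/seteqP; split => x /=; rewrite /reflection !in_itv/= => /andP[? ?];
  apply/andP; split; lra.
Qed.

Lemma ge0_integral_reflection (c : R) (f : R -> \bar R) :
  measurable_fun setT f -> (forall x, 0 <= f x)%E ->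
  (\int[mu]_x f (c - x)%R = \int[mu]_x f x)%E.
Proof.
move=> mf f0.
have /= <- := @ge0_integral_pushforward _ _ _ _ _ _
  (measurable_reflection c) mu setT f measurableT mf (fun y _ => f0 y).
by apply: eq_measure_integral => A mA _; exact: lebesgue_measure_reflection.
Qed.

Lemma ge0_integral_translation (c : R) (f : R -> \bar R) :
  measurable_fun setT f -> (forall x, 0 <= f x)%E ->
  (\int[mu]_x f (x - c)%R = \int[mu]_x f x)%E.
Proof.
move=> mf f0.
have mg : measurable_fun setT (fun x : R => f (- c - x)).
  by apply: (measurableT_comp mf); exact: measurable_reflection.
transitivity (\int[mu]_x (fun x => f (- c - x)%R) (0 - x)%R)%E.
  by apply: eq_integral => x _; congr f; lra.
rewrite (ge0_integral_reflection 0 mg) => [|x]; last exact: f0.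
exact: (ge0_integral_reflection (- c)).
Qed.

Lemma Rintegral_reflection (c : R) (f : R -> R) : measurable_fun setT f ->
  (\int[mu]_x f (c - x) = \int[mu]_x f x)%R.
Proof.
move=> mf; have mfE : measurable_fun setT (EFin \o f) by exact/measurable_EFinP.
rewrite /Rintegral integralE [in RHS]integralE; congr (fine (_ - _)%E).
  rewrite -(ge0_integral_reflection c (measurable_funepos mfE))//.
  by apply: eq_integral => x _; rewrite !unlock.
rewrite -(ge0_integral_reflection c (measurable_funeneg mfE))//.
by apply: eq_integral => x _; rewrite !unlock.
Qed.

Lemma cint_reflection (c : R) (F : R -> R[i]) : cmeasurableR F ->
  cint mu (fun x => F (c - x)) = cint mu F.
Proof.
by move=> [a b]; congr Complex;
  [rewrite -(Rintegral_reflection c a)|rewrite -(Rintegral_reflection c b)].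
Qed.

End Lebesgue_reflection.

Section Convolution.
Context {R : realType}.
Local Notation mu := (@lebesgue_measure R).
Local Notation cmeasurableR := (@cmeasurable _ (measurableTypeR R) R).
Local Notation cmeasurableRR :=
  (@cmeasurable _ (measurableTypeR R * measurableTypeR R)%type R).

Lemma cmeasurable_comp d (T : measurableType d) (F : R -> R[i]) (f : T -> R) :
  cmeasurableR F -> measurable_fun setT f -> cmeasurable (fun x => F (f x)).
Proof.
by move=> [a b] mf; split; [exact: (measurableT_comp a)|exact: (measurableT_comp b)].
Qed.

Lemma cmeasurable_fst (F : R -> R[i]) : cmeasurableR F ->
  cmeasurableRR (fun z : R * R => F z.1).
Proof. by move=> mF; apply: cmeasurable_comp. Qed.

Lemma cmeasurable_snd (F : R -> R[i]) : cmeasurableR F ->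
  cmeasurableRR (fun z : R * R => F z.2).
Proof. by move=> mF; apply: cmeasurable_comp. Qed.

Lemma cmeasurable_sub (F : R -> R[i]) : cmeasurableR F ->
  cmeasurableRR (fun z : R * R => F (z.1 - z.2)).
Proof.
move=> mF; apply: cmeasurable_comp => //.
by apply: measurable_funB; [exact: measurable_fst|exact: measurable_snd].
Qed.

(** Tonelli, with translation invariance for the inner integral. Asking only for domination of [F]
    leaves room for the cutoffs and unimodular factors carried by the kernels. *)
Lemma conv_integral_le (F : R * R -> R[i]) (f g : R -> R[i]) :
  cmeasurableRR F -> cintegrable mu f -> cintegrable mu g ->
  (forall x y, nc (F (x, y)) <= nc (f (x - y)) * nc (g y)) ->
  (\int[mu \x mu]_z (nc (F z))%:E <=
   \int[mu]_x (nc (f x))%:E * \int[mu]_x (nc (g x))%:E)%E.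
Proof.
move=> mF cf cg Ffg.
have mn := cmeasurable_normc mF.
have mf := cmeasurable_normc (cintegrable_cmeasurable cf).
have mg := cmeasurable_normc (cintegrable_cmeasurable cg).
have n0 (z : R[i]) : (0%:E <= (nc z)%:E)%E by rewrite lee_fin normc_ge0.
rewrite (@fubini_tonelli1 _ _ _ _ _ mu mu (fun z => (nc (F z))%:E))//=; last exact/measurable_EFinP.
rewrite (@fubini_tonelli _ _ _ _ _ mu mu (fun z => (nc (F z))%:E))//=; last exact/measurable_EFinP.
rewrite -ge0_integralZl//; first last.
- exact: integral_ge0.
- exact/measurable_EFinP.
apply: ge0_le_integral => //.
- by move=> y _; exact: integral_ge0.
- apply: (@measurable_fun_fubini_tonelli_G _ _ _ _ _ mu (fun z => (nc (F z))%:E)) => //.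
  exact/measurable_EFinP.
- by apply: emeasurable_funM => //; exact/measurable_EFinP.
move=> y _.
rewrite -(ge0_integral_translation y (f := fun x => (nc (f x))%:E))//; last exact/measurable_EFinP.
have mfy : measurable_fun setT (fun x : R => (nc (f (x - y : R)))%:E).
  apply/measurable_EFinP; apply: (measurableT_comp mf).
  exact: measurable_funB.
rewrite -ge0_integralZr//.
apply: ge0_le_integral => //.
- apply/measurable_EFinP; apply: (measurableT_comp mn).
  exact: measurable_pair2.
- by apply: emeasurable_funM.
- by move=> x _; rewrite -EFinM lee_fin.
Qed.

Lemma cintegrable_conv (F : R * R -> R[i]) (f g : R -> R[i]) :
  cmeasurableRR F -> cintegrable mu f -> cintegrable mu g ->
  (forall x y, nc (F (x, y)) <= nc (f (x - y)) * nc (g y)) ->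
  cintegrable (mu \x mu)%E F.
Proof.
move=> mF cf cg Ffg; apply/cintegrableP; split => //.
apply: (le_lt_trans (conv_integral_le mF cf cg Ffg)).
apply: lte_mul_pinfty.
- by apply: integral_ge0 => y _; rewrite lee_fin normc_ge0.
- by apply: integrable_fin_num => //; exact: cintegrable_normc.
- by apply: integrable_lty => //; exact: cintegrable_normc.
Qed.

(** Multiplication by this complex indicator replaces integrals over a segment by integrals over the
    line, the form in which Fubini and the convolution bound are stated. *)
Definition cutoff (A : set R) (x : R) : R[i] := Complex (\1_A x) 0.

Lemma cutoffT (A : set R) x : A x -> cutoff A x = 1.
Proof. by move=> Ax; rewrite /cutoff indicE mem_set. Qed.

Lemma cutoffF (A : set R) x : ~ A x -> cutoff A x = 0.
Proof. by move=> Ax; rewrite /cutoff indicE memNset. Qed.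

Lemma normc_cutoff (A : set R) x : nc (cutoff A x) = \1_A x.
Proof. by rewrite normc_real ger0_norm// indicE. Qed.

Lemma cmeasurable_cutoff (A : set R) : measurable A -> cmeasurableR (cutoff A).
Proof. by move=> mA; split => //=; exact: measurable_indic. Qed.

Lemma cutoff_integrable (a b : R) : cintegrable mu (cutoff `[a, b]).
Proof.
apply: (@le_cintegrable _ _ _ _ _ (\1_`[a, b] : measurableTypeR R -> R)).
- by apply: cmeasurable_cutoff.
- exact: integrable_indic_itv.
- by move=> x; rewrite normc_cutoff.
Qed.

Lemma Cintegral_cint (A : set R) (F : R -> R[i]) :
  Cintegral A F = cint mu (fun x => cutoff A x * F x).
Proof.
rewrite /Cintegral /cint; congr Complex; rewrite [LHS]Rintegral_mkcond;
  apply: eq_Rintegral => x _; rewrite patchE /cutoff indicE;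
  case: (F x) => a b /=; case: ifP => _ /=; rewrite ?mul1r ?mul0r ?subr0 ?addr0//.
Qed.

Lemma Cintegral_setT (F : R -> R[i]) : Cintegral setT F = cint mu F.
Proof. by []. Qed.

End Convolution.

(** * The Krein equation on the Fourier side *)

Section KreinIdentity.
Context {R : realType}.
Local Notation mu := (@lebesgue_measure R).
Local Notation cmeasurableR := (@cmeasurable _ (measurableTypeR R) R).
Local Notation cmeasurableRR :=
  (@cmeasurable _ (measurableTypeR R * measurableTypeR R)%type R).
Variables (r : R) (G : R -> R[i]).
Hypothesis iG : cintegrable mu G.
Hypothesis suppG : forall x, ~ `[0, r]%classic x -> G x = 0.

Let k := cutoff `[0, r].
(** For x and y in [0, r] the difference x - y lies in [-r, r], so this is the only part of a kernel
    that the equation sees. *)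
Let k2 := cutoff `[- r, r].

Definition ghat (l : R) : R[i] := cint mu (fun s => G s * expi (- (l * s))).

Definition dirichlet (x : R) : R[i] :=
  cint mu (fun s => k s * expi (x * s)).

(* The Fourier transform at [l] of [h] minus the convolution of [h] and [G],
   cut off to [0, r]. *)
Definition kernel_transform (h : R -> R[i]) (l : R) : R[i] :=
  cint mu (fun s => k s * h s * expi (- (l * s))) -
  cint (mu \x mu)%E
    (fun z => k z.1 * h (z.1 - z.2) * G z.2 * expi (- (l * z.1))).

Let mG : cmeasurableR G. Proof. exact: cintegrable_cmeasurable iG. Qed.

Let mk : cmeasurableR k. Proof. exact: cmeasurable_cutoff. Qed.

Let me1 (l : R) : cmeasurableR (fun s : R => expi (- (l * s))).
Proof.
by apply: cmeasurable_expi; apply: measurableT_comp.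
Qed.

Let me2 (l : R) : cmeasurableR (fun s : R => expi (l * s)).
Proof. by apply: cmeasurable_expi; exact: measurable_funM. Qed.

Let meM : cmeasurableRR (fun z : R * R => expi (z.1 * z.2)).
Proof.
apply: cmeasurable_expi; apply: measurable_funM.
  exact: measurable_fst.
exact: measurable_snd.
Qed.

Lemma cintegrableMexpi d (T : measurableType d) (m : {measure set T -> \bar R})
    (F : T -> R[i]) (f : T -> R) :
  cintegrable m F -> cmeasurable (fun x => expi (f x)) ->
  cintegrable m (fun x => F x * expi (f x)).
Proof.
by move=> iF mf; apply: (@cintegrableM _ _ _ _ _ _ 1) => // x; rewrite normc_expi.
Qed.

Lemma normc_ghat_le l : ((nc (ghat l))%:E <= 2%:E * \int[mu]_x (nc (G x))%:E)%E.
Proof.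
apply: (le_trans (normc_cint_le _ _)).
  exact: cmeasurableM.
rewrite le_eqVlt; apply/orP; left; apply/eqP; congr (_ * _)%E.
by apply: eq_integral => x _; rewrite Normc.normcM normc_expi mulr1.
Qed.

Lemma normc_ghat_le_fine l : nc (ghat l) <= 2 * fine (\int[mu]_x (nc (G x))%:E)%E.
Proof.
rewrite -lee_fin EFinM fineK ?normc_ghat_le//.
by apply: integrable_fin_num => //; exact: cintegrable_normc.
Qed.

Lemma cmeasurable_ghat : cmeasurableR ghat.
Proof.
apply: (@cmeasurable_cint_param _ _ _ _ _ mu
  (fun z : R * R => G z.2 * expi (- (z.1 * z.2)))).
apply: cmeasurableM; first exact: cmeasurable_snd.
apply: cmeasurable_expi; apply: measurableT_comp => //.
apply: measurable_funM.
  exact: measurable_fst.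
exact: measurable_snd.
Qed.

Lemma cmeasurable_dirichlet : cmeasurableR dirichlet.
Proof.
apply: (@cmeasurable_cint_param _ _ _ _ _ mu
  (fun z : R * R => k z.2 * expi (z.1 * z.2))).
by apply: cmeasurableM => //; exact: cmeasurable_snd.
Qed.

Let kh_le (h : R -> R[i]) s : nc (k s * h s) <= nc (k2 s * h s).
Proof.
rewrite !Normc.normcM; apply: ler_wpM2r; first exact: normc_ge0.
rewrite /k /k2 !normc_cutoff !indicE.
have [|] := boolP (s \in `[0, r]%classic); rewrite ?inE/= ?in_itv/=.
  by move=> /andP[s0 sr]; rewrite mem_set//= in_itv/=; apply/andP; split; lra.
by move=> _; rewrite ler0n.
Qed.

Let khG_le (h : R -> R[i]) (l x y : R) :
  nc (k x * h (x - y) * G y * expi (- (l * x))) <=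
  nc (k2 (x - y) * h (x - y)) * nc (G y).
Proof.
rewrite !Normc.normcM normc_expi mulr1.
have [yr|yr] := pselect (`[0, r]%classic y); last first.
  by rewrite (suppG yr) Normc.normc0 !mulr0.
apply: ler_wpM2r; first exact: normc_ge0.
apply: ler_wpM2r; first exact: normc_ge0.
rewrite /k /k2 !normc_cutoff !indicE.
move: yr; rewrite /= in_itv/= => /andP[y0 yr].
have [|] := boolP (x \in `[0, r]%classic); rewrite ?inE/= ?in_itv/=.
  by move=> /andP[s0 sr]; rewrite mem_set//= in_itv/=; apply/andP; split; lra.
by move=> _; rewrite ler0n.
Qed.

Section fixed_h.
Variables (h : R -> R[i]) (l : R).
Hypotheses (mh : cmeasurableR h) (ih : cintegrable mu (fun x => k2 x * h x)).

Lemma kernel_transform_integrable1 :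
  cintegrable mu (fun s => k s * h s * expi (- (l * s))).
Proof.
apply: cintegrableMexpi => //; apply: (cintegrable_le _ ih) => //.
exact: cmeasurableM.
Qed.

Let mF : cmeasurableRR (fun z : R * R => k z.1 * h (z.1 - z.2) * G z.2 * expi (- (l * z.1))).
Proof.
apply: cmeasurableM; last exact: (cmeasurable_fst (me1 l)).
apply: cmeasurableM; last exact: cmeasurable_snd.
apply: cmeasurableM; first exact: cmeasurable_fst.
exact: cmeasurable_sub.
Qed.

Lemma kernel_transform_integrable2 : cintegrable (mu \x mu)%E
  (fun z => k z.1 * h (z.1 - z.2) * G z.2 * expi (- (l * z.1))).
Proof.
by apply: (cintegrable_conv mF ih iG) => x y; exact: khG_le.
Qed.

(** The right side does not depend on [l] and is linear in the L^1 (-r, r) size of [h]; applied to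
    the difference between H and its approximation, it controls the truncation error. *)
Lemma kernel_transform_le : ((nc (kernel_transform h l))%:E <=
  2%:E * \int[mu]_x (nc (k2 x * h x))%:E +
  2%:E * (\int[mu]_x (nc (k2 x * h x))%:E * \int[mu]_x (nc (G x))%:E))%E.
Proof.
apply: (@le_trans _ _ ((nc (cint mu (fun s => k s * h s * expi (- (l * s)))))%:E +
  (nc (cint (mu \x mu)%E
    (fun z => k z.1 * h (z.1 - z.2) * G z.2 * expi (- (l * z.1)))))%:E)%E).
  rewrite -EFinD lee_fin; apply: (le_trans (normcD_le _ _)).
  by rewrite normcN.
apply: leeD.
  apply: (le_trans (normc_cint_le _ _)).
    exact: cintegrable_cmeasurable kernel_transform_integrable1.
  apply: lee_wpmul2l => //; apply: ge0_le_integral => //.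
  - by move=> x _; rewrite lee_fin normc_ge0.
  - apply/measurable_EFinP/cmeasurable_normc.
    exact: cintegrable_cmeasurable kernel_transform_integrable1.
  - apply/measurable_EFinP/cmeasurable_normc.
    exact: cintegrable_cmeasurable ih.
  - by move=> x _; rewrite lee_fin Normc.normcM normc_expi mulr1 kh_le.
apply: (le_trans (normc_cint_le _ mF)).
apply: lee_wpmul2l => //.
by apply: (conv_integral_le mF ih iG) => x y; exact: khG_le.
Qed.

(** The Krein equation is multiplied by [expi (- (l * s))] and integrated in [s]. Fubini provides
    integrable slices for almost every [s], which suffices because the equation is itself an almost
    everywhere statement. *)
Lemma ghat_kernel_transform :
  {ae mu, forall s, k s * G s + k s * cint mu (fun y => h (s - y) * G y) = k s * h s} ->
  ghat l = kernel_transform h l.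
Proof.
move=> eqG.
have i1 := kernel_transform_integrable1.
have i2 := kernel_transform_integrable2.
rewrite /kernel_transform -cint_prod1//.
have i3 := cintegrable_param i2.
rewrite -cintB//.
apply: ae_eq_cint.
- exact: cmeasurableM.
- exact: (cmeasurableB (cintegrable_cmeasurable i1) (cintegrable_cmeasurable i3)).
apply: (ae_mono2 _ eqG (ae_cintegrable i2)) => s eqs is_ /=.
have [sr|sr] := pselect (`[0, r]%classic s); last first.
  rewrite (suppG sr) /k cutoffF// !mul0r sub0r.
  rewrite [X in cint _ X](_ : _ = (fun=> 0 * 0)); last first.
    by apply/funext => y; rewrite !mul0r.
  by rewrite cintZl ?mul0r ?oppr0//; split; rewrite /=; exact: integrable0.
move: eqs is_; rewrite /k cutoffT// !mul1r => eqs is_.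
(* The slice given by Fubini carries a unimodular factor; multiplying by its inverse recovers
   integrability of the bare convolution integrand. *)
have is2 : cintegrable mu (fun y => h (s - y) * G y).
  have := cintegrableZl (expi (l * s)) is_.
  congr cintegrable; apply/funext => y /=.
  have E : expi (l * s) * expi (- (l * s)) = 1 by rewrite -expiD addrN expi0.
  rewrite ?cutoffT//.
  transitivity (h (s - y) * G y * (expi (l * s) * expi (- (l * s)))); first ring.
  by rewrite E mulr1.
rewrite [X in cint _ X](_ : _ = (fun y => h (s - y) * G y * expi (- (l * s)))); last first.
  by apply/funext => y /=; rewrite ?cutoffT// ?mul1r.
rewrite cintZr// -mulrBl -eqs; congr (_ * _).
by rewrite addrK.
Qed.

End fixed_h.

Lemma kernel_transformB (h1 h2 : R -> R[i]) (l : R) :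
  cmeasurableR h1 -> cintegrable mu (fun x => k2 x * h1 x) ->
  cmeasurableR h2 -> cintegrable mu (fun x => k2 x * h2 x) ->
  kernel_transform (fun x => h1 x - h2 x) l =
  kernel_transform h1 l - kernel_transform h2 l.
Proof.
move=> m1 i1 m2 i2; rewrite /kernel_transform.
have a1 := kernel_transform_integrable1 l m1 i1.
have a2 := kernel_transform_integrable1 l m2 i2.
have b1 := kernel_transform_integrable2 l m1 i1.
have b2 := kernel_transform_integrable2 l m2 i2.
rewrite (_ : cint mu _ = cint mu (fun s => k s * h1 s * expi (- (l * s))) -
  cint mu (fun s => k s * h2 s * expi (- (l * s)))); last first.
  by rewrite -(cintB a1 a2); congr cint; apply/funext => x; ring.
rewrite (_ : cint (mu \x mu)%E _ =
  cint (mu \x mu)%E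
    (fun z => k z.1 * h1 (z.1 - z.2) * G z.2 * expi (- (l * z.1))) -
  cint (mu \x mu)%E
    (fun z => k z.1 * h2 (z.1 - z.2) * G z.2 * expi (- (l * z.1)))); last first.
  by rewrite -(cintB b1 b2); congr cint; apply/funext => x; ring.
by ring.
Qed.

Section fourier_kernel.
Variables (c : R[i]) (U : R -> R[i]).
Hypothesis iU : cintegrable mu U.

Let mU : cmeasurableR U. Proof. exact: cintegrable_cmeasurable iU. Qed.

Let h x := c * cint mu (fun y => U y * expi (y * x)).

Lemma cmeasurable_fourier : cmeasurableR h.
Proof.
apply: cmeasurableM; first exact: cmeasurable_cst.
apply: (@cmeasurable_cint_param _ _ _ _ _ mu
  (fun z : R * R => U z.2 * expi (z.2 * z.1))).
apply: cmeasurableM; first exact: cmeasurable_snd.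
by apply: cmeasurable_expi; apply: measurable_funM;
  [exact: measurable_snd|exact: measurable_fst].
Qed.

Lemma normc_fourier_le x :
  nc (h x) <= nc c * (2 * fine (\int[mu]_y (nc (U y))%:E)%E).
Proof.
rewrite Normc.normcM; apply: ler_wpM2l; first exact: normc_ge0.
rewrite -lee_fin EFinM fineK; last first.
  by apply: integrable_fin_num => //; exact: cintegrable_normc.
apply: (le_trans (normc_cint_le _ _)).
  apply: cmeasurableM => //; apply: cmeasurable_expi.
  exact: measurable_funM.
rewrite le_eqVlt; apply/orP; left; apply/eqP; congr (_ * _)%E.
by apply: eq_integral => y _; rewrite Normc.normcM normc_expi mulr1.
Qed.

Lemma cintegrable_cutoff_fourier : cintegrable mu (fun x => k2 x * h x).
Proof.
apply: cintegrableM; last exact: normc_fourier_le.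
  exact: cutoff_integrable.
exact: cmeasurable_fourier.
Qed.

(** The convolution theorem. Integrability of [U] makes the double integral absolutely convergent;
    this is the place where a truncation of u is required instead of u. *)
Lemma fourier_conv s :
  cint mu (fun y => h (s - y) * G y) =
  c * cint mu (fun x => U x * ghat x * expi (x * s)).
Proof.
pose F (z : R * R) := U z.2 * G z.1 * expi (z.2 * (s - z.1)).
have mF : cmeasurableRR F.
  apply: cmeasurableM; last first.
    apply: cmeasurable_expi; apply: measurable_funM; first exact: measurable_snd.
    by apply: measurable_funB => //; exact: measurable_fst.
  by apply: cmeasurableM; [exact: cmeasurable_snd|exact: cmeasurable_fst].
have iF : cintegrable (mu \x mu)%E F.
  apply: (cintegrable_prod mF iG iU) => x y.
  by rewrite /F !Normc.normcM normc_expi mulr1 mulrC.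
have iUe x : cintegrable mu (fun y => U y * expi (y * x)).
  by apply: cintegrableMexpi => //; apply: cmeasurable_expi; exact: measurable_funM.
transitivity (c * cint mu (fun y => cint mu (fun x => F (y, x)))).
  rewrite -cintZl; last exact: cintegrable_param.
  congr cint; apply/funext => y; rewrite /h -mulrA -cintZr//.
  by congr (_ * cint _ _); apply/funext => x; rewrite /F/=; ring.
rewrite cint_prod1// -cint_prod2//; congr (_ * cint _ _).
apply/funext => x; rewrite /ghat.
rewrite [RHS](_ : _ = cint mu (fun y => G y * expi (- (x * y)) * (U x * expi (x * s)))); last first.
  by rewrite cintZr; [ring|exact: cintegrableMexpi].
congr cint; apply/funext => y; rewrite /F/= mulrBr expiD; ring.
Qed.

(** By [fourier_conv], convolving with [G] multiplies the density [U] by [ghat], so the two terms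
    merge into the density [U * (1 - ghat)]. What remains in [s] is the integral of an exponential
    over [0, r], that is, the Dirichlet kernel at [x - l]. *)
Lemma kernel_transform_fourier l : kernel_transform h l =
  c * cint mu (fun x => U x * (1 - ghat x) * dirichlet (x - l)).
Proof.
pose V x := U x * (1 - ghat x).
have iV : cintegrable mu V.
  apply: (cintegrableM (c := 1 + 2 * fine (\int[mu]_x (nc (G x))%:E)%E) iU).
    apply: cmeasurableB; [exact: cmeasurable_cst|exact: cmeasurable_ghat].
  move=> x; apply: (le_trans (normcD_le _ _)).
  by rewrite normcN Normc.normc1 lerD2l normc_ghat_le_fine.
have mV : cmeasurableR V by exact: cintegrable_cmeasurable iV.
have iUg : cintegrable mu (fun x => U x * ghat x).
  apply: (cintegrableM iU cmeasurable_ghat) => x.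
  exact: normc_ghat_le_fine.
pose F (z : R * R) := k z.1 * V z.2 * expi ((z.2 - l) * z.1).
have mF : cmeasurableRR F.
  apply: cmeasurableM; last first.
    apply: cmeasurable_expi; apply: measurable_funM; last exact: measurable_fst.
    by apply: measurable_funB => //; exact: measurable_snd.
  by apply: cmeasurableM; [exact: cmeasurable_fst|exact: cmeasurable_snd].
have ik : cintegrable mu k by exact: cutoff_integrable.
have iF : cintegrable (mu \x mu)%E F.
  apply: (cintegrable_prod mF ik iV) => x y.
  by rewrite /F !Normc.normcM normc_expi mulr1.
have mh := cmeasurable_fourier.
have ih := cintegrable_cutoff_fourier.
have i1 := kernel_transform_integrable1 l mh ih.
have i2 := kernel_transform_integrable2 l mh ih.
rewrite /kernel_transform -cint_prod1// -cintB//; last exact: (cintegrable_param i2).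
have iVe s : cintegrable mu (fun x => V x * expi (x * s)).
  by apply: cintegrableMexpi => //; apply: cmeasurable_expi; exact: measurable_funM.
have iUe s : cintegrable mu (fun x => U x * expi (x * s)).
  by apply: cintegrableMexpi => //; apply: cmeasurable_expi; exact: measurable_funM.
have iUge s : cintegrable mu (fun x => U x * ghat x * expi (x * s)).
  by apply: cintegrableMexpi => //; apply: cmeasurable_expi; exact: measurable_funM.
transitivity (c * cint mu (fun s => cint mu (fun x => F (s, x)))).
  rewrite -cintZl; last exact: cintegrable_param.
  congr cint; apply/funext => s.
  have ihG : cintegrable mu (fun y => h (s - y) * G y).
    under eq_fun do rewrite mulrC.
    apply: (cintegrableM iG) => [|y]; last exact: normc_fourier_le.
    by apply: (cmeasurable_comp mh); exact: measurable_funB.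
  rewrite [X in _ - X](_ : _ = k s * expi (- (l * s)) * cint mu (fun y => h (s - y) * G y)); last first.
    by rewrite -cintZl//; congr cint; apply/funext => y /=; ring.
  rewrite fourier_conv /h.
  rewrite [RHS](_ : _ = c * (k s * expi (- (l * s)) * cint mu (fun x => V x * expi (x * s)))); last first.
    rewrite -(cintZl _ (iVe s)); congr (_ * cint _ _); apply/funext => x.
    by rewrite /F/= mulrBl expiD; ring.
  rewrite [cint mu (fun x => V x * _)](_ : _ = cint mu (fun x => U x * expi (x * s)) -
     cint mu (fun x => U x * ghat x * expi (x * s))); last first.
    by rewrite -cintB//; congr cint; apply/funext => x; rewrite /V; ring.
  by ring.
rewrite cint_prod1// -cint_prod2//; congr (_ * cint _ _).
apply/funext => x; rewrite /dirichlet -cintZl.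
  by congr cint; apply/funext => s; rewrite /F /V/=; ring.
by apply: cintegrableMexpi.
Qed.

(** The factor 1 - ghat is replaced by its sup bound 1 + 2 |G|_1; the outer 2 comes from
    [normc_cint_le]. *)
Lemma normc_kernel_transform_fourier_le l :
  ((nc (kernel_transform h l))%:E <=
   (nc c * (2 * (1 + 2 * fine (\int[mu]_x (nc (G x))%:E)%E)))%:E *
   \int[mu]_x (nc (U x) * nc (dirichlet (x - l)))%:E)%E.
Proof.
have mD : cmeasurableR (fun x => dirichlet (x - l)).
  by apply: (cmeasurable_comp cmeasurable_dirichlet); exact: measurable_funB.
have mW : cmeasurableR (fun x => U x * (1 - ghat x) * dirichlet (x - l)).
  apply: cmeasurableM => //; apply: cmeasurableM => //.
  apply: cmeasurableB; [exact: cmeasurable_cst|exact: cmeasurable_ghat].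
have n0 (z : R[i]) : (0%:E <= (nc z)%:E)%E by rewrite lee_fin normc_ge0.
rewrite kernel_transform_fourier Normc.normcM EFinM.
rewrite [X in (_ <= X * _)%E]EFinM -muleA; apply: lee_wpmul2l => //.
apply: (le_trans (normc_cint_le _ mW)).
rewrite EFinM -muleA; apply: lee_wpmul2l => //.
have mUD : measurable_fun setT
    (fun x : measurableTypeR R => (nc (U x) * nc (dirichlet (x - l)))%:E).
  apply/measurable_EFinP; apply: measurable_funM; exact: cmeasurable_normc.
have UD0 x : (0 <= (nc (U x) * nc (dirichlet (x - l)))%:E)%E.
  by rewrite lee_fin mulr_ge0// normc_ge0.
have G0 : 0 <= fine (\int[mu]_x (nc (G x))%:E)%E.
  by apply: fine_ge0; apply: integral_ge0.
rewrite -ge0_integralZl//; last by rewrite lee_fin addr_ge0// mulr_ge0.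
apply: ge0_le_integral => //.
- by apply/measurable_EFinP; exact: cmeasurable_normc.
- by apply: emeasurable_funM.
move=> x _; rewrite -EFinM lee_fin !Normc.normcM mulrA.
apply: ler_wpM2r; first exact: normc_ge0.
rewrite mulrC; apply: ler_wpM2r; first exact: normc_ge0.
apply: (le_trans (normcD_le _ _)).
by rewrite normcN Normc.normc1 lerD2l normc_ghat_le_fine.
Qed.

End fourier_kernel.

End KreinIdentity.

(** * The Dirichlet kernel and a Young-type inequality *)

Section Weight.
Context {R : realType}.
Local Notation mu := (@lebesgue_measure R).

Lemma FTC_is_derive (f F : R -> R) (a b : R) : a < b ->
  (forall x, a <= x <= b -> is_derive x 1 F (f x)) ->
  (forall x, a <= x <= b -> {for x, continuous f}) ->
  (\int[mu]_(x in `[a, b]) (f x)%:E = (F b - F a)%:E)%E.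
Proof.
move=> ab dF cf.
have cF x : a <= x <= b -> {for x, continuous F}.
  move=> /dF dFx; apply: differentiable_continuous.
  by apply/derivable1_diffP; exact: ex_derive.
rewrite (continuous_FTC2 ab (F := F)) ?EFinB//.
- apply: continuous_in_subspaceT => x.
  by rewrite inE/= in_itv/= => /cf.
- split.
  + by move=> x; rewrite in_itv/= => /andP[ax xb]; apply: ex_derive;
      apply: dF; rewrite !ltW.
  + by apply: cvg_at_right_filter; apply: cF; rewrite lexx ltW.
  + by apply: cvg_at_left_filter; apply: cF; rewrite lexx ltW.
- move=> x; rewrite in_itv/= => /andP[ax xb].
  by rewrite derive1E; have := dF x; rewrite !ltW// => /(_ isT) [_ ->].
Qed.

(** The factor [x] stays on the left so that x = 0 is covered as well. *)
Lemma Rintegral_cosM (x r : R) : 0 < r ->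
  (x * \int[mu]_(s in `[0, r]) cos (x * s) = sin (x * r))%R.
Proof.
move=> r0; have [->|x0] := eqVneq x 0; first by rewrite !mul0r sin0.
have dF s : 0 <= s <= r -> is_derive s 1 (fun s => x^-1 * sin (x * s)) (cos (x * s)).
  move=> _; have d1 := is_derive_sin (x * s).
  have d2 : is_derive s 1 (fun s => x * s : R) x.
    by apply: is_derive_eq; rewrite /GRing.scale/= mulr1.
  have d3 := is_derive1_comp d1 d2.
  by apply: is_derive_eq; rewrite /GRing.scale/=; field.
have cf s : 0 <= s <= r -> {for s, continuous (fun s => cos (x * s))}.
  move=> _; apply: continuous_comp; last exact: continuous_cos.
  by apply: continuousM; [exact: cst_continuous|exact: cvg_id].
rewrite /Rintegral (FTC_is_derive r0 dF cf) /= !mulr0 sin0 mulr0 subr0.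
by rewrite mulrA divff// mul1r.
Qed.

Lemma Rintegral_sinM (x r : R) : 0 < r ->
  (x * \int[mu]_(s in `[0, r]) sin (x * s) = 1 - cos (x * r))%R.
Proof.
move=> r0; have [->|x0] := eqVneq x 0; first by rewrite !mul0r cos0 subrr.
have dF s : 0 <= s <= r ->
    is_derive s 1 (fun s => - (x^-1 * cos (x * s))) (sin (x * s)).
  move=> _; have d1 := is_derive_cos (x * s).
  have d2 : is_derive s 1 (fun s => x * s : R) x.
    by apply: is_derive_eq; rewrite /GRing.scale/= mulr1.
  have d3 := is_derive1_comp d1 d2.
  by apply: is_derive_eq; rewrite /GRing.scale/=; field.
have cf s : 0 <= s <= r -> {for s, continuous (fun s => sin (x * s))}.
  move=> _; apply: continuous_comp; last exact: continuous_sin.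
  by apply: continuousM; [exact: cst_continuous|exact: cvg_id].
rewrite /Rintegral (FTC_is_derive r0 dF cf) /= !mulr0 cos0 mulr1 opprK.
by rewrite mulrDr mulrN mulrA divff// mul1r addrC.
Qed.

(** Every power above 1 of this majorant is integrable, but the majorant itself is not; hence the
    strict inequalities between exponents below. *)
Definition decay (x : R) : R := (1 + `|x|)^-1.

Lemma decay_gt0 x : 0 < decay x.
Proof. by rewrite invr_gt0 ltr_pwDl. Qed.

Lemma decay_le1 x : decay x <= 1.
Proof. by rewrite invf_le1 ?lerDl// ltr_pwDl. Qed.

Lemma continuous_decay : continuous decay.
Proof.
move=> x; apply: cvgV; first by rewrite gt_eqF// ltr_pwDl.
by apply: cvgD; [exact: cvg_cst|apply: cvg_norm; exact: cvg_id].
Qed.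

(** The two summands of 1 + |x| are treated separately: the length of the segment gives 2 r, and |x|
    times the kernel is at most |sin (x r)| + |1 - cos (x r)|, hence at most 3. *)
Lemma normc_dirichlet_le (r x : R) : 0 < r ->
  nc (dirichlet r x) <= (2 * r + 3) * decay x.
Proof.
move=> r0; rewrite ler_pdivlMr ?ltr_pwDl// mulrDr mulr1.
apply: lerD.
  rewrite -lee_fin; apply: (le_trans (normc_cint_le _ _)).
    apply: cmeasurableM; first exact: cmeasurable_cutoff.
    by apply: cmeasurable_expi; exact: measurable_funM.
  rewrite EFinM; apply: lee_wpmul2l => //.
  rewrite [leLHS](_ : _ = \int[mu]_x (\1_`[0%R, r] x)%:E)%E.
    rewrite integral_indic//= setIT lebesgue_measure_itv/= lte_fin r0.
    by rewrite -EFinB subr0.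
  apply: eq_integral => s _.
  by rewrite Normc.normcM normc_expi mulr1 normc_cutoff.
rewrite mulrC; apply: (@le_trans _ _ (`|x| * (`|\int[mu]_(s in `[0, r]) cos (x * s)|
    + `|\int[mu]_(s in `[0, r]) sin (x * s)|))%R).
  apply: ler_wpM2l => //.
  have -> : dirichlet r x = Complex (\int[mu]_(s in `[0, r]) cos (x * s))%R
    (\int[mu]_(s in `[0, r]) sin (x * s))%R by rewrite /dirichlet -Cintegral_cint.
  exact: normc_le_ReIm.
rewrite mulrDr -!normrM Rintegral_cosM// Rintegral_sinM//.
have := cos_geN1 (x * r); have := cos_le1 (x * r).
have := sin_geN1 (x * r); have := sin_le1 (x * r).
move=> s1 sN1 c1 cN1.
have h1 : `|sin (x * r)| <= 1 by rewrite ler_norml sN1.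
have h2 : `|1 - cos (x * r)| <= 2 by rewrite ger0_norm; lra.
lra.
Qed.

Lemma continuous_powR_pos (p x : R) : 0 < x -> {for x, continuous (fun y : R => y `^ p)}.
Proof.
move=> x0; apply: differentiable_continuous; apply/derivable1_diffP.
by apply: ex_derive; exact: is_derive1_powR.
Qed.

Lemma decay_powR_integrable (s : R) : 1 < s ->
  mu.-integrable setT (fun x => (decay x `^ s)%:E).
Proof.
move=> s1.
have cE : continuous (fun x => decay x `^ s).
  move=> x; have h := @continuous_powR_pos s (decay x) (decay_gt0 x).
  exact: (cvg_comp _ _ (@continuous_decay x) h).
have mE : measurable_fun setT (fun x => decay x `^ s).
  exact: continuous_measurable_fun.
have E0 x : 0 <= decay x `^ s by exact: powR_ge0.
apply/integrableP; split; first exact/measurable_EFinP.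
under eq_integral do rewrite gee0_abs ?lee_fin//.
rewrite ge0_symfun_integralT//; last by move=> x; rewrite /= /decay normrN.
apply: lte_mul_pinfty => //.
rewrite [X in integral _ X _](_ : _ = `[0%R, +oo[%classic); last first.
  by apply/seteqP; split => x /=; rewrite in_itv/= andbT.
have cvE := ge0_cvgn_integral (mu := mu) E0 mE.
rewrite -(cvg_lim _ cvE)//.
(* This is the integral of (1 + x)^(-s) over the half line; the antiderivative on [0, n] stays below
   it. *)
apply: (@le_lt_trans _ _ ((s - 1)^-1%:E)); last exact: ltry.
apply: lime_le; first by apply/cvg_ex; exists (\int[mu]_(x in `[0%R, +oo[) (decay x `^ s)%:E)%E.
near=> n.
have n0 : (0 : R) < n%:R by rewrite ltr0n; near: n; exact: nbhs_infty_gt.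
rewrite (_ : integral _ _ _ = \int[mu]_(x in `[0%R, n%:R]) ((1 + x) `^ (- s))%:E)%E; last first.
  apply: eq_integral => x; rewrite inE/= in_itv/= => /andP[x0 _].
  by rewrite /decay ger0_norm// -powR_inv1 ?addr_ge0// -powRrM mulN1r.
have dF (x : R) : 0 <= x <= n%:R ->
    is_derive x 1 (fun x => (1 - s)^-1 * (1 + x) `^ (1 - s)) ((1 + x) `^ (- s)).
  move=> /andP[x0 _].
  have x10 : 0 < 1 + x by lra.
  have d1 := is_derive1_powR (1 - s) x10.
  have d2 : is_derive x 1 (fun x => 1 + x : R) 1.
    by apply: is_derive_eq; rewrite add0r mulr1.
  have d3 := is_derive1_comp d1 d2.
  apply: is_derive_eq; rewrite /GRing.scale/=.
  have -> : 1 - s - 1 = - s by ring.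
  by field; lra.
have cf (x : R) : 0 <= x <= n%:R -> {for x, continuous (fun x : R => (1 + x) `^ (- s))}.
  move=> /andP[x0 _].
  apply: (@continuous_comp _ _ _ (fun x : R => 1 + x) (fun y : R => y `^ (- s))).
    by apply: continuousD; [exact: cst_continuous|exact: cvg_id].
  by apply: continuous_powR_pos; lra.
rewrite (FTC_is_derive n0 dF cf) lee_fin addr0 powR1 mulr1.
have := powR_ge0 (1 + n%:R : R) (1 - s).
set P := powR _ _ => P0.
rewrite -[(1 - s)^-1]opprK -invrN opprB.
have : 0 <= (s - 1)^-1 * P by rewrite mulr_ge0// invr_ge0; lra.
lra.
Unshelve. all: by end_near. Qed.

End Weight.

(** * A pointwise Young-type inequality for the decaying kernel *)

Section Young.
Context {R : realType}.
Local Notation mu := (@lebesgue_measure R).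
Local Notation cmeasurableRR :=
  (@cmeasurable _ (measurableTypeR R * measurableTypeR R)%type R).

(* Weighted AM-GM with weights [1/p], [t], [1 - theta]; since [E <= 1], the
   total power [(1 + t) (1 - t)] of [E] on the right may fall short of 1. *)
Lemma young_pointwise (p theta t V E Z : R) : 1 < p -> p^-1 < theta <= 1 ->
  0 <= V -> 0 < E <= 1 -> 0 < Z ->
  t = theta - p^-1 ->
  V `^ theta * E <= Z `^ p^-1 * (Z^-1 * (V * E `^ (1 + t)) + V + E `^ (1 + t)).
Proof.
move=> p1 /andP[pt t1] V0 /andP[E0 E1] Z0 tE.
have ip0 : 0 < p^-1 by rewrite invr_gt0; lra.
have t0 : 0 < t by rewrite tE; lra.
have rhs0 : 0 <= Z `^ p^-1 * (Z^-1 * (V * E `^ (1 + t)) + V + E `^ (1 + t)).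
  by rewrite mulr_ge0 ?powR_ge0// !addr_ge0// ?mulr_ge0 ?powR_ge0// invr_ge0 ltW.
(* For V = 0 there is no logarithm to take, but the left side vanishes because theta is positive. *)
move: V0; rewrite le_eqVlt => /predU1P[V0|V0].
  by move: rhs0; rewrite -V0 powR0 ?mul0r//; lra.
set u := ln V; set e := ln E; set z := ln Z.
have EV : V = expR u by rewrite lnK.
have EE : E = expR e by rewrite lnK.
have EZ : Z = expR z by rewrite lnK.
have e0 : e <= 0 by rewrite /e ln_le0.
have pE (x y : R) : expR x `^ y = expR (y * x) by rewrite /powR expRK gt_eqF ?expR_gt0.
rewrite EV EE EZ !pE -expRN -!expRD.
set L := theta * u + e.
set x1 := p^-1 * z - z + u + (1 + t) * e.
set x2 := p^-1 * z + u.
set x3 := p^-1 * z + (1 + t) * e.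
rewrite !mulrDr -!expRD.
have -> : p^-1 * z + (- z + (u + (1 + t) * e)) = x1 by rewrite /x1; ring.
rewrite -/x2 -/x3.
have ge0 (x y : R) : 0 <= expR x + expR y by rewrite addr_ge0 ?expR_ge0.
have [h|h1] := leP L x1.
  by apply: (le_trans (y := expR x1)); rewrite ?ler_expR// -addrA lerDl.
have [h|h2] := leP L x2.
  by apply: (le_trans (y := expR x2)); rewrite ?ler_expR// addrAC lerDr.
have [h|h3] := leP L x3.
  by apply: (le_trans (y := expR x3)); rewrite ?ler_expR// lerDr.
(* If [L] exceeded all three exponents, the weighted average of the differences would be positive;
   yet it equals [t ^+ 2 * e], and [e <= 0] because E is at most 1. *)
exfalso.
have g1 : 0 < p^-1 * (L - x1) by rewrite mulr_gt0// subr_gt0.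
have g2 : 0 < t * (L - x2) by rewrite mulr_gt0// subr_gt0.
have g3 : 0 <= (1 - theta) * (L - x3) by rewrite mulr_ge0 ?subr_ge0// ltW.
have : 0 < p^-1 * (L - x1) + t * (L - x2) + (1 - theta) * (L - x3) by lra.
have -> : p^-1 * (L - x1) + t * (L - x2) + (1 - theta) * (L - x3) = t ^+ 2 * e.
  rewrite /L /x1 /x2 /x3; have -> : theta = t + p^-1 by rewrite tE; ring.
  ring.
by rewrite ltNge; rewrite mulr_ge0_le0 ?sqr_ge0.
Qed.

Lemma decay_sym (x y : R) : decay (x - y) = decay (y - x).
Proof. by rewrite /decay distrC. Qed.

(** This is [young_pointwise] with Z = A l, integrated in x. Up to the positive correction added
    below, A is the convolution of v with a power of [decay] above 1, so it is integrable by the L^1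
    convolution bound. *)
Lemma young_decay (v : R -> R) (p theta : R) : 1 < p -> p^-1 < theta <= 1 ->
  (forall x, 0 <= v x) -> mu.-integrable setT (fun x => (v x)%:E) ->
  exists A : R -> R, exists C : R,
    [/\ forall l, 0 <= A l, mu.-integrable setT (fun l => (A l)%:E), 0 <= C
      & forall l, (\int[mu]_x (v x `^ theta * decay (x - l))%:E <=
                   (C * A l `^ p^-1)%:E)%E].
Proof.
move=> p1 pt v0 iv.
(* [s] is the exponent 1 + t of [young_pointwise]; the slack between 1/p and theta is what puts it
   above 1. *)
set s := 1 + (theta - p^-1).
have s1 : 1 < s by rewrite /s; move: pt => /andP[? ?]; lra.
have mv : @measurable_fun _ _ (measurableTypeR R) _ setT v.
  by move/measurable_int/measurable_EFinP : iv.
have ie := decay_powR_integrable s1.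
have me : @measurable_fun _ _ (measurableTypeR R) _ setT (fun x : R => decay x `^ s).
  by move/measurable_int/measurable_EFinP : ie.
have e01 x : 0 <= decay x `^ s <= 1.
  rewrite powR_ge0 /=.
  apply: (@le_trans _ _ (decay x)); last exact: decay_le1.
  by apply: ge1r_powR; [rewrite decay_gt0 decay_le1|exact: ltW].
pose f (x : R) : R[i] := Complex (decay x `^ s) 0.
pose g (x : R) : R[i] := Complex (v x) 0.
have cI (h : R -> R) : mu.-integrable setT (fun x => (h x)%:E) ->
    cintegrable mu (fun x => Complex (h x) 0).
  by move=> ih; split => //=; exact: integrable0.
have cf : cintegrable mu f by exact: cI.
have cg : cintegrable mu g by exact: cI.
pose F (z : R * R) := f (z.1 - z.2) * g z.2.
have mF : cmeasurableRR F.
  apply: cmeasurableM.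
    exact: (cmeasurable_sub (cintegrable_cmeasurable cf)).
  exact: (cmeasurable_snd (cintegrable_cmeasurable cg)).
have iF : cintegrable (mu \x mu)%E F.
  by apply: (cintegrable_conv mF cf cg) => x y; rewrite Normc.normcM.
pose W (z : R * R) := decay (z.1 - z.2) `^ s * v z.2.
have iW : (mu \x mu)%E.-integrable setT (EFin \o W).
  have [+ _] := iF; congr (_.-integrable _ _); apply/funext => z.
  by rewrite /F /f /g /W /= mulr0 subr0.
have iA := integrable_Rintegral_param iW.
pose A0 (l : R) := (\int[mu]_y W (l, y))%R.
(* Finiteness holds at every [l], not just almost everywhere, because powers of [decay] are at most
   1 and v is integrable. *)
have WE l : (\int[mu]_y (W (l, y))%:E = (A0 l)%:E)%E.
  rewrite /A0 /Rintegral fineK//; apply: integrable_fin_num => //.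
  apply: (le_integrable measurableT _ _ iv).
  - apply/measurable_EFinP; apply: measurable_funM => //.
    exact: (measurableT_comp me (measurable_reflection l)).
  - move=> y _; rewrite /W/= lee_fin normrM ler_piMl//.
    by have /andP[? ?] := e01 (l - y); rewrite ger0_norm.
have A00 l : 0 <= A0 l.
  apply: Rintegral_ge0 => y _; rewrite /W mulr_ge0//.
  by have /andP[] := e01 (l - y).
(* The added term keeps [A l] positive, so that it can be divided by, and preserves
   integrability. *)
pose A l := A0 l + decay l `^ s.
have A0p l : 0 < A l by rewrite /A ltr_wpDl// powR_gt0// decay_gt0.
(* The three summands bound the three integrated terms of [young_pointwise]: the quotient of [A0 l]
   by [A l] is at most 1, and the others are the masses of v and of the power of [decay]. *)
exists A, (1 + (\int[mu]_x v x)%R + (\int[mu]_x (decay x `^ s))%R).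
have Iv0 : 0 <= (\int[mu]_x v x)%R by apply: Rintegral_ge0.
have Ie0 : 0 <= (\int[mu]_x (decay x `^ s))%R.
  by apply: Rintegral_ge0 => x _; have /andP[] := e01 x.
split.
- by move=> l; exact: ltW.
- exact: (integrableD measurableT iA ie).
- by rewrite !addr_ge0.
move=> l.
have iWl : mu.-integrable setT (fun y => (W (l, y))%:E).
  apply: (le_integrable measurableT _ _ iv).
  - apply/measurable_EFinP; apply: measurable_funM => //.
    exact: (measurableT_comp me (measurable_reflection l)).
  - move=> y _; rewrite /W/= lee_fin normrM ler_piMl//.
    by have /andP[? ?] := e01 (l - y); rewrite ger0_norm.
have mel : @measurable_fun _ _ (measurableTypeR R) _ setT
    (fun y => (decay (l - y) `^ s)%:E).
  by apply/measurable_EFinP; apply: (measurableT_comp me); exact: measurable_funB.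
have mW : measurable_fun setT (fun y : measurableTypeR R => (W (l, y))%:E) by exact: measurable_int iWl.
have mvE : measurable_fun setT (fun y : measurableTypeR R => (v y)%:E) by exact: measurable_int iv.
have W0 y : 0 <= W (l, y).
  by rewrite /W mulr_ge0//; have /andP[] := e01 (l - y).
have iel : (\int[mu]_y (decay (l - y) `^ s)%:E = (\int[mu]_x (decay x `^ s))%R%:E)%E.
  rewrite (ge0_integral_reflection l (f := fun x => (decay x `^ s)%:E)).
  - by rewrite /Rintegral fineK//; exact: integrable_fin_num.
  - exact/measurable_EFinP.
  - by move=> x; rewrite lee_fin; have /andP[] := e01 x.
apply: (@le_trans _ _ (\int[mu]_y ((A l `^ p^-1)%:E *
   (((A l)^-1)%:E * (W (l, y))%:E + (v y)%:E + (decay (l - y) `^ s)%:E)))%E).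
  apply: ge0_le_integral => //.
  - by move=> y _; rewrite lee_fin mulr_ge0 ?powR_ge0// ltW// decay_gt0.
  - apply/measurable_EFinP; apply: measurable_funM.
      exact: (measurableT_comp (measurable_powR _)).
    apply: (@measurableT_comp _ _ _ _ _ _ (@decay R)).
      by apply: continuous_measurable_fun; exact: continuous_decay.
    exact: measurable_funB.
  - apply: emeasurable_funM => //; apply: emeasurable_funD => //.
    by apply: emeasurable_funD => //; exact: emeasurable_funM.
  move=> y _.
  rewrite [leRHS](_ : _ = (A l `^ p^-1 *
    ((A l)^-1 * W (l, y) + v y + decay (l - y) `^ s))%:E)//.
  rewrite lee_fin decay_sym /W /=.
  rewrite [decay (l - y) `^ s * _]mulrC.
  by apply: young_pointwise => //; rewrite decay_gt0 decay_le1.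
rewrite ge0_integralZl//; last 3 first.
- apply: emeasurable_funD => //; apply: emeasurable_funD => //.
  exact: emeasurable_funM.
- move=> y _; apply: adde_ge0; last by rewrite lee_fin powR_ge0.
  apply: adde_ge0; last by rewrite lee_fin.
  by apply: mule_ge0; rewrite lee_fin// invr_ge0 ltW.
- by rewrite lee_fin powR_ge0.
rewrite [leRHS]EFinM muleC; apply: lee_wpmul2r; first by rewrite lee_fin powR_ge0.
have i1 : (0 <= (A l)^-1) by rewrite invr_ge0 ltW.
rewrite ge0_integralD//; last 3 first.
- move=> y _; apply: adde_ge0; last by rewrite lee_fin.
  by apply: mule_ge0; rewrite lee_fin.
- by apply: emeasurable_funD => //; exact: emeasurable_funM.
- by move=> y _; rewrite lee_fin powR_ge0.
rewrite ge0_integralD//; last 3 first.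
- by move=> y _; apply: mule_ge0; rewrite lee_fin.
- exact: emeasurable_funM.
- by move=> y _; rewrite lee_fin.
rewrite ge0_integralZl//; last by move=> y _; rewrite lee_fin.
rewrite WE iel.
have -> : (\int[mu]_x (v x)%:E = (\int[mu]_x v x)%R%:E)%E.
  by rewrite /Rintegral fineK//; exact: integrable_fin_num.
rewrite -EFinM -!EFinD lee_fin !lerD2r.
by rewrite mulrC ler_pdivrMr// mul1r /A lerDl powR_ge0.
Qed.

End Young.

(** * Approximation of the accelerant *)

Section Truncation.
Context {R : realType}.
Local Notation mu := (@lebesgue_measure R).

Lemma integrable_tail (f : R -> R) : mu.-integrable setT (fun x => (f x)%:E) ->
  (fun n => (\int[mu]_x (`|f x| * (1 - \1_`[- n%:R, n%:R] x))%:E)%E)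
    @ \oo --> 0%E.
Proof.
move=> intf.
have mf : @measurable_fun _ _ (measurableTypeR R) _ setT f.
  by move/measurable_int/measurable_EFinP : intf.
have := @dominated_cvg _ (measurableTypeR R) R mu setT measurableT
  (fun n x => (`|f x| * (1 - \1_`[- n%:R, n%:R] x))%:E) (cst 0%E)
  (fun x => `|f x|%:E).
rewrite integral0; apply => //.
- move=> n; apply/measurable_EFinP; apply: measurable_funM.
    exact: measurableT_comp.
  by apply: measurable_funB => //; exact: measurable_indic.
- move=> x _; apply: cvg_near_cst; near=> n.
  rewrite indicE mem_set ?subrr ?mulr0//= in_itv/= -ler_norml.
  by near: n; exact: nbhs_infty_ger.
- exact: integrable_norm.
- move=> n x _; rewrite /= lee_fin normrM normr_id ler_piMr//.
  by rewrite indicE; case: (_ \in _); rewrite ?subrr ?subr0 ?normr0 ?normr1.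
Unshelve. all: by end_near. Qed.

(** The truncation built into [is_fourier_L2], recast as a complex density on the whole line. *)
Definition restrictc (n : nat) (f : R -> R) (x : R) : R[i] :=
  Complex (\1_`[- n%:R, n%:R] x * f x) 0.

Lemma fourier_on_truncation (n : nat) (f : R -> R) (x : R) :
  fourier_on `[- n%:R, n%:R] f x =
  cint mu (fun y => restrictc n f y * expi (y * x)).
Proof.
rewrite /fourier_on Cintegral_cint; congr cint; apply/funext => y.
by rewrite mulrA; congr (_ * _); rewrite /cutoff /restrictc; apply/eqP;
  rewrite eq_complex/= !mulr0 !mul0r subr0 addr0 !eqxx.
Qed.

Lemma cintegrable_real (f : R -> R) : mu.-integrable setT (fun x => (f x)%:E) ->
  cintegrable mu (fun x => Complex (f x) 0).
Proof. by move=> ih; split => //=; exact: integrable0. Qed.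

Lemma restrictc_integrable1 (n : nat) (f : R -> R) :
  f \in Lfun mu 1%:E -> cintegrable mu (restrictc n f).
Proof.
move=> /Lfun1_integrable fi; apply: cintegrable_real.
have mf : @measurable_fun _ _ (measurableTypeR R) _ setT f.
  by move/measurable_int/measurable_EFinP : fi.
apply: (le_integrable measurableT _ _ fi).
  by apply/measurable_EFinP; apply: measurable_funM => //; exact: measurable_indic.
move=> x _; rewrite /= lee_fin normrM ler_piMl// indicE.
by case: (_ \in _); rewrite ?normr0 ?normr1.
Qed.

Lemma restrictc_integrable2 (n : nat) (f : R -> R) :
  f \in Lfun mu 2%:E -> cintegrable mu (restrictc n f).
Proof.
move=> f2; have fi := Lfun2_integrable_sqr f2; apply: cintegrable_real.
have mf : @measurable_fun _ _ (measurableTypeR R) _ setT f.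
  by move: f2; rewrite inE => /andP[]; rewrite inE.
have := integrableD measurableT fi (integrable_indic_itv (- n%:R) n%:R true false).
apply: le_integrable => //.
  by apply/measurable_EFinP; apply: measurable_funM => //; exact: measurable_indic.
move=> x _; rewrite /= lee_fin indicE [leRHS]ger0_norm; last first.
  by rewrite addr_ge0 ?sqr_ge0.
case: (_ \in _); last by rewrite mul0r normr0 addr_ge0 ?sqr_ge0.
rewrite mul1r -[X in _ <= X + _]real_normK ?num_real//.
(* This inequality stands in for Cauchy-Schwarz: on a bounded interval it bounds |f| by an
   integrable function. *)
have g (t : R) : t <= t ^+ 2 + 1 by have := sqr_ge0 (t - 1); have := sqr_ge0 t; nra.
exact: g.
Qed.

End Truncation.

Section LocalApproximation.
Context {R : realType}.
Local Notation mu := (@lebesgue_measure R).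
Local Notation cmeasurableR := (@cmeasurable _ (measurableTypeR R) R).
Variables (u : R -> R) (F : R -> R[i]).
Hypothesis uF : is_fourier_L1L2 u F.

Lemma restrictc_integrable (n : nat) : cintegrable mu (restrictc n u).
Proof.
have [f1 [f2 [F2 [h1 h2 uE _ _]]]] := uF.
have := cintegrableD (restrictc_integrable1 n h1) (restrictc_integrable2 n h2).
congr cintegrable; apply/funext => x; rewrite /restrictc uE mulrDr.
by apply/eqP; rewrite eq_complex/= addr0 !eqxx.
Qed.

Lemma fourier_L1L2_measurable : cmeasurableR F.
Proof.
have [f1 [f2 [F2 [h1 h2 uE [mF2 _] FE]]]] := uF.
have -> : F = fun x => fourier_on setT f1 x + F2 x by apply/funext.
apply: cmeasurableD; last exact: mF2.
move/Lfun1_integrable : h1 => /cintegrable_real/cintegrable_cmeasurable mf1.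
apply: (@cmeasurable_cint_param _ _ _ _ _ mu
  (fun z : R * R => Complex (f1 z.2) 0 * expi (z.2 * z.1))).
apply: cmeasurableM; first exact: (cmeasurable_snd mf1).
by apply: cmeasurable_expi; apply: measurable_funM;
  [exact: measurable_snd|exact: measurable_fst].
Qed.

(** On [-r, r] the L^1 part of u contributes a uniform error, the tail of its integral, and the L^2
    part an error small in L^2; on a bounded interval both are small in L^1. The same truncation
    order serves both parts, so the approximation can be written with u alone. *)
Lemma fourier_L1L2_approx (r eta : R) : 0 < r -> 0 < eta ->
  exists n : nat, (\int[mu]_x (nc (cutoff `[- r, r] x *
     (F x - cint mu (fun y => restrictc n u y * expi (y * x)))))%:E <= eta%:E)%E.
Proof.
move=> r0 eta0.
have [f1 [f2 [F2 [h1 h2 uE [mF2 cvF2] FE]]]] := uF.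
have i1 := h1; move/Lfun1_integrable : i1 => i1.
have mf1 : @measurable_fun _ _ (measurableTypeR R) _ setT f1.
  by move/measurable_int/measurable_EFinP : i1.
have cf1 := cintegrable_real i1.
have cvf1 := integrable_tail i1.
pose a n := (\int[mu]_x (`|f1 x| * (1 - \1_`[- n%:R, n%:R] x))%:E)%E.
pose D n x := fourier_on `[- n%:R, n%:R] f2 x - F2 x.
pose b n := (\int[mu]_x (nc (D n x) ^+ 2)%:E)%E.
(* The uniform error 2 e, plus e from splitting |D| <= e + D^2 / e, costs 3 e over length 2 r, which
   is 3/4 of [eta]; the bound e eta / 4 on the integral of D^2 accounts for the last quarter. *)
pose e := eta / (8 * r).
have e0 : 0 < e by rewrite divr_gt0// mulr_gt0.
have : \forall n \near \oo, (a n < e%:E)%E /\ (b n < (e * (eta / 4))%:E)%E.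
  have e1 : 0 < e * (eta / 4) by rewrite mulr_gt0// divr_gt0.
  have nb (t : R) : 0 < t -> nbhs 0%E [set y : \bar R | (y < t%:E)%E].
    by move=> t0; apply: open_nbhs_nbhs; split => /=;
      [exact: open_ereal_lt_ereal|rewrite lte_fin].
  have A := cvf1 _ (nb _ e0); have B := cvF2 _ (nb _ e1).
  by near=> n; split; near: n.
move=> [N _ /(_ N (leqnn N)) [aN bN]].
exists N.
have me (x : R) : cmeasurableR (fun y => expi (y * x)).
  by apply: cmeasurable_expi; exact: measurable_funM.
have iR1 := restrictc_integrable1 N h1.
have iR2 := restrictc_integrable2 N h2.
have eE (x : R) : F x - cint mu (fun y => restrictc N u y * expi (y * x)) =
    cint mu (fun y => (Complex (f1 y) 0 - restrictc N f1 y) * expi (y * x)) - D N x.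
  have j1 := cintegrableMexpi cf1 (me x).
  have j2 := cintegrableMexpi iR1 (me x).
  have j3 := cintegrableMexpi iR2 (me x).
  rewrite (_ : cint mu (fun y => restrictc N u y * _) =
    cint mu (fun y => restrictc N f1 y * expi (y * x)) +
    cint mu (fun y => restrictc N f2 y * expi (y * x))); last first.
    rewrite -cintD//; congr cint; apply/funext => y; rewrite -mulrDl.
    congr (_ * _); apply/eqP; rewrite /restrictc uE mulrDr.
    by rewrite eq_complex/= addr0 !eqxx.
  rewrite (_ : cint mu (fun y => (_ - _) * _) =
    cint mu (fun y => Complex (f1 y) 0 * expi (y * x)) -
    cint mu (fun y => restrictc N f1 y * expi (y * x))); last first.
    by rewrite -cintB//; congr cint; apply/funext => y; rewrite mulrBl.
  rewrite FE /D fourier_on_truncation /fourier_on Cintegral_setT.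
  by ring.
have nD x : 0 <= nc (D N x) by exact: normc_ge0.
have mD : cmeasurableR (D N).
  apply: cmeasurableB; last exact: mF2.
  rewrite (_ : fourier_on _ f2 = (fun x => cint mu (fun y => restrictc N f2 y * expi (y * x)))).
    apply: (@cmeasurable_cint_param _ _ _ _ _ mu
      (fun z : R * R => restrictc N f2 z.2 * expi (z.2 * z.1))).
    apply: cmeasurableM; first exact: (cmeasurable_snd (cintegrable_cmeasurable iR2)).
    by apply: cmeasurable_expi; apply: measurable_funM;
      [exact: measurable_snd|exact: measurable_fst].
  by apply/funext => x; exact: fourier_on_truncation.
have aE x : nc (cint mu (fun y => (Complex (f1 y) 0 - restrictc N f1 y) * expi (y * x))) <= 2 * e.
  rewrite -lee_fin.
  have j0 := cintegrableB cf1 iR1.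
  have j1 := cintegrableMexpi j0 (me x).
  apply: (le_trans (normc_cint_le _ (cintegrable_cmeasurable j1))).
  rewrite EFinM; apply: lee_wpmul2l => //; apply: le_trans (ltW aN).
  rewrite le_eqVlt; apply/orP; left; apply/eqP; apply: eq_integral => y _.
  rewrite Normc.normcM normc_expi mulr1 /restrictc.
  rewrite (_ : _ - _ = Complex (f1 y * (1 - \1_`[- N%:R, N%:R] y)) 0); last first.
    by apply/eqP; rewrite eq_complex/= oppr0 addr0 mulrBr mulr1 mulrC !eqxx.
  rewrite normc_real normrM; congr (_ * _)%:E; apply: ger0_norm.
  by rewrite subr_ge0 indicE lern1 leq_b1.
apply: (@le_trans _ _ (\int[mu]_x ((3 * e)%:E * (\1_`[- r, r] x)%:E +
    e^-1%:E * (nc (D N x) ^+ 2)%:E))%E).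
  apply: ge0_le_integral => //.
  - by move=> x _; rewrite lee_fin normc_ge0.
  - apply/measurable_EFinP/cmeasurable_normc; apply: cmeasurableM.
      exact: cmeasurable_cutoff.
    apply: cmeasurableB; first exact: fourier_L1L2_measurable.
    apply: (@cmeasurable_cint_param _ _ _ _ _ mu
      (fun z : R * R => restrictc N u z.2 * expi (z.2 * z.1))).
    apply: cmeasurableM; first exact: (cmeasurable_snd (cintegrable_cmeasurable (restrictc_integrable N))).
    by apply: cmeasurable_expi; apply: measurable_funM;
      [exact: measurable_snd|exact: measurable_fst].
  - apply: emeasurable_funD; apply: emeasurable_funM => //.
      by apply/measurable_EFinP; exact: measurable_indic.
    by apply/measurable_EFinP; apply: measurable_funX; exact: cmeasurable_normc.
  move=> x _; rewrite [leRHS](_ : _ = (3 * e * \1_`[- r, r] x + e^-1 * nc (D N x) ^+ 2)%:E)//.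
  rewrite lee_fin Normc.normcM normc_cutoff eE indicE.
  case: (_ \in _); last first.
    by rewrite mul0r mulr0 add0r mulr_ge0 ?sqr_ge0// invr_ge0 ltW.
  rewrite mul1r mulr1; apply: (le_trans (normcD_le _ _)); rewrite normcN.
  have := aE x; set X := nc (cint _ _) => X2.
  have : nc (D N x) <= e + e^-1 * nc (D N x) ^+ 2.
    rewrite -(ler_pM2l e0) mulrDr mulVKf ?gt_eqF//.
    have := sqr_ge0 (e - nc (D N x)); have := nD x; nra.
  lra.
have bm : measurable_fun setT (fun x : measurableTypeR R => (nc (D N x) ^+ 2)%:E).
  by apply/measurable_EFinP; apply: measurable_funX; exact: cmeasurable_normc.
have im : measurable_fun setT (fun x : measurableTypeR R => (\1_`[- r, r] x : R)%:E).
  by apply/measurable_EFinP; exact: measurable_indic.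
have ei0 : 0 <= e^-1 by rewrite invr_ge0 ltW.
have i0 x : 0 <= \1_`[- r, r] x :> R by rewrite indicE.
rewrite ge0_integralD//; last 4 first.
- by move=> x _; apply: mule_ge0; rewrite lee_fin// mulr_ge0// ltW.
- exact: emeasurable_funM.
- by move=> x _; apply: mule_ge0; rewrite lee_fin// sqr_ge0.
- exact: emeasurable_funM.
rewrite ge0_integralZl//; last by rewrite lee_fin mulr_ge0// ltW.
rewrite ge0_integralZl//; last by move=> x _; rewrite lee_fin sqr_ge0.
rewrite integral_indic//= setIT lebesgue_measure_itv/= lte_fin gtrN// -EFinB.
apply: (@le_trans _ _ ((3 * e)%:E * (r - - r)%:E + e^-1%:E * (e * (eta / 4))%:E)%E).
  by apply: leeD => //; apply: lee_wpmul2l; rewrite ?lee_fin// ltW.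
rewrite [leLHS](_ : _ = (3 * e * (r - - r) + e^-1 * (e * (eta / 4)))%:E)//.
rewrite lee_fin mulKf ?gt_eqF// /e.
rewrite (_ : 3 * (eta / (8 * r)) * (r - - r) = 3 / 4 * eta); last by field; rewrite gt_eqF.
lra.
Unshelve. all: by end_near. Qed.

End LocalApproximation.

(** * From truncations to the bound on the transform of the kernel *)

Section KreinBound.
Context {R : realType}.
Local Notation mu := (@lebesgue_measure R).
Local Notation cmeasurableR := (@cmeasurable _ (measurableTypeR R) R).

Lemma fourier_L1L2_integrable (u : R -> R) (F : R -> R[i]) (r : R) :
  is_fourier_L1L2 u F -> 0 < r -> cintegrable mu (fun x => cutoff `[- r, r] x * F x).
Proof.
(* Only finiteness is wanted, so tolerance 1 suffices: near 0, F is a bounded transform plus an L^1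
   error. *)
move=> uF r0; have [n le1] := fourier_L1L2_approx uF r0 ltr01.
have mF := fourier_L1L2_measurable uF.
have iU := restrictc_integrable uF n.
have mFn := cmeasurable_fourier 1 iU.
have iFn := cintegrable_cutoff_fourier r 1 iU.
have mk : cmeasurableR (cutoff `[- r, r]) by exact: cmeasurable_cutoff.
have iD : cintegrable mu (fun x => cutoff `[- r, r] x *
    (F x - cint mu (fun y => restrictc n u y * expi (y * x)))).
  apply/cintegrableP; split; last by apply: (le_lt_trans le1); exact: ltry.
  apply: cmeasurableM => //; apply: cmeasurableB => //.
  by move: mFn; under eq_fun do rewrite mul1r.
have := cintegrableD iD iFn.
by congr cintegrable; apply/funext => x; ring.
Qed.

(** By linearity of [kernel_transform], H is split into an approximation and an error. Since
    |restrictc n u| <= |u|, the first part has a bound free of [n]; the second is made smaller than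
    an arbitrary [e], and [n] disappears from the conclusion. *)
Lemma ghat_krein_le (u : R -> R) (F G : R -> R[i]) (c : R[i]) (r : R) :
  is_fourier_L1L2 u F -> 0 < r -> measurable_fun setT u ->
  cintegrable mu G -> (forall x, ~ `[0, r]%classic x -> G x = 0) ->
  {ae mu, forall s, cutoff `[0, r] s * G s + cutoff `[0, r] s *
     cint mu (fun y => c * F (s - y) * G y) = cutoff `[0, r] s * (c * F s)} ->
  exists2 C : R, 0 <= C & forall l : R,
    ((nc (ghat G l))%:E <= C%:E * \int[mu]_x (`|u x| * decay (x - l))%:E)%E.
Proof.
move=> uF r0 mu_ iG suppG eqG.
have nG := cintegrable_normc iG.
set gG := fine (\int[mu]_x (nc (G x))%:E)%E.
have gGE : (\int[mu]_x (nc (G x))%:E = gG%:E)%E.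
  by rewrite /gG fineK//; exact: integrable_fin_num.
have gG0 : 0 <= gG.
  by apply: fine_ge0; apply: integral_ge0 => x _; rewrite lee_fin normc_ge0.
have mF := fourier_L1L2_measurable uF.
have iF := fourier_L1L2_integrable uF r0.
have mH : cmeasurableR (fun x => c * F x).
  by apply: cmeasurableM => //; exact: cmeasurable_cst.
have iH : cintegrable mu (fun x => cutoff `[- r, r] x * (c * F x)).
  have := cintegrableZl c iF.
  by congr cintegrable; apply/funext => x; ring.
pose C1 := nc c * (2 * (1 + 2 * gG)).
have C10 : 0 <= C1.
  by rewrite /C1 mulr_ge0 ?normc_ge0// mulr_ge0// addr_ge0// mulr_ge0.
exists (C1 * (2 * r + 3)); first by rewrite mulr_ge0//; lra.
move=> l.
have mul : measurable_fun setT (fun x : measurableTypeR R => (`|u x| * decay (x - l))%:E).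
  apply/measurable_EFinP; apply: measurable_funM; first exact: measurableT_comp.
  apply: (@measurableT_comp _ _ _ _ _ _ (@decay R)).
    by apply: continuous_measurable_fun; exact: continuous_decay.
  exact: measurable_funB.
have ul0 x : (0%:E <= (`|u x| * decay (x - l))%:E)%E.
  by rewrite lee_fin mulr_ge0// ltW// decay_gt0.
apply/lee_addgt0Pr => e e0.
(* [K] is the factor of the L^1 error in [kernel_transform_le]; the tolerance is divided by K + 1
   because K may be 0. *)
pose K := (2 + 2 * gG) * nc c.
have K0 : 0 <= K by rewrite mulr_ge0 ?normc_ge0// addr_ge0// mulr_ge0.
have eta0 : 0 < e / (K + 1) by rewrite divr_gt0// ltr_wpDl.
have [n len] := fourier_L1L2_approx uF r0 eta0.
have iU := restrictc_integrable uF n.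
pose hn (x : R) := c * cint mu (fun y => restrictc n u y * expi (y * x)).
have mhn : cmeasurableR hn by exact: cmeasurable_fourier.
have ihn : cintegrable mu (fun x => cutoff `[- r, r] x * hn x).
  exact: cintegrable_cutoff_fourier.
have mD : cmeasurableR (fun x => c * F x - hn x) by exact: cmeasurableB.
have iD : cintegrable mu (fun x => cutoff `[- r, r] x * (c * F x - hn x)).
  by have := cintegrableB iH ihn; congr cintegrable; apply/funext => x; ring.
have -> : ghat G l = kernel_transform r G hn l +
    kernel_transform r G (fun x => c * F x - hn x) l.
  rewrite (ghat_kernel_transform iG suppG l mH iH eqG).
  by rewrite (kernel_transformB iG suppG l mH iH mhn ihn); ring.
apply: (@le_trans _ _ ((nc (kernel_transform r G hn l))%:E +
   (nc (kernel_transform r G (fun x => c * F x - hn x) l))%:E)%E).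
  by rewrite -EFinD lee_fin normcD_le.
apply: leeD.
- apply: (le_trans (normc_kernel_transform_fourier_le iG suppG c iU l)).
  rewrite -/gG -/C1 [X in (_ <= X * _)%E]EFinM -muleA; apply: lee_wpmul2l => //.
  rewrite -ge0_integralZl//; last by rewrite lee_fin; lra.
  have mdl : cmeasurableR (fun x => dirichlet r (x - l)).
    by apply: (cmeasurable_comp (@cmeasurable_dirichlet R r)); exact: measurable_funB.
  apply: ge0_le_integral => //.
  + by move=> x _; rewrite lee_fin mulr_ge0// normc_ge0.
  + apply/measurable_EFinP; apply: measurable_funM; apply: cmeasurable_normc => //.
    exact: cintegrable_cmeasurable iU.
  + exact: emeasurable_funM.
  + move=> x _; rewrite -EFinM lee_fin mulrCA.
    apply: ler_pM; rewrite ?normc_ge0//; last exact: normc_dirichlet_le.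
    rewrite /restrictc normc_real normrM ler_piMl// indicE.
    by case: (_ \in _); rewrite ?normr0 ?normr1.
- apply: (le_trans (kernel_transform_le iG suppG l mD iD)); rewrite gGE.
  have -> : (\int[mu]_x (nc (cutoff `[- r, r] x * (c * F x - hn x)))%:E =
     (nc c)%:E * \int[mu]_x (nc (cutoff `[- r, r] x *
     (F x - cint mu (fun y => restrictc n u y * expi (y * x)))))%:E)%E.
    rewrite -ge0_integralZl//.
    + apply: eq_integral => x _; rewrite -EFinM -Normc.normcM; congr (nc _)%:E.
      by rewrite /hn; ring.
    + apply/measurable_EFinP; apply: cmeasurable_normc.
      apply: cmeasurableM; first exact: cmeasurable_cutoff.
      apply: cmeasurableB => //.
      by have := cmeasurable_fourier 1 iU; under eq_fun do rewrite mul1r.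
    + by move=> x _; rewrite lee_fin normc_ge0.
    + by rewrite lee_fin normc_ge0.
  move: len; set I := (\int[mu]_x _)%E => len.
  have I0 : (0 <= I)%E by apply: integral_ge0 => x _; rewrite lee_fin normc_ge0.
  have : I \is a fin_num by rewrite ge0_fin_numE//; apply: (le_lt_trans len); exact: ltry.
  move=> /fineK IE; move: len; rewrite -IE -!EFinM -EFinD !lee_fin => len.
  move: I0; rewrite -IE lee_fin => I0.
  set i := fine I in len I0 *.
  have -> : 2 * (nc c * i) + 2 * (nc c * i * gG) = K * i by rewrite /K; ring.
  apply: (@le_trans _ _ (K * (e / (K + 1)))); first exact: ler_wpM2l.
  by rewrite mulrA ler_pdivrMr ?ltr_wpDl// mulrDr mulr1 mulrC lerDl ltW.
Qed.

End KreinBound.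

(** * Weighted integrability of the Krein solution *)

Section KreinP.
Context {R : realType}.
Local Notation mu := (@lebesgue_measure R).
Local Notation cmeasurableR := (@cmeasurable _ (measurableTypeR R) R).

Lemma in_L2_segment_integrable (r : R) (G : R -> R[i]) : in_L2_segment r G ->
  cintegrable mu (fun x => cutoff `[0, r] x * G x).
Proof.
move=> [[mr mi] iG].
have mI : measurable `[0, r]%classic by exact: measurable_itv.
have mG : cmeasurableR (fun x => cutoff `[0, r] x * G x).
  split.
    rewrite (_ : (fun x => _) = (fun x => complex.Re (G x)) \_ `[0, r]).
      exact: ((measurable_restrictT _ mI).1 mr).
    apply/funext => x; rewrite patchE ReM /cutoff/= mul0r subr0 indicE.
    by case: ifP => _; rewrite ?mul1r ?mul0r.
  rewrite (_ : (fun x => _) = (fun x => complex.Im (G x)) \_ `[0, r]).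
    exact: ((measurable_restrictT _ mI).1 mi).
  apply/funext => x; rewrite patchE ImM /cutoff/= mul0r addr0 indicE.
  by case: ifP => _; rewrite ?mul1r ?mul0r.
have mn := cmeasurable_normc mG.
have ii := integrable_indic_itv (0 : R) r true false.
have i2 : mu.-integrable setT (fun x => (nc (cutoff `[0, r] x * G x) ^+ 2)%:E).
  apply/integrableP; split.
    by apply/measurable_EFinP; exact: measurable_funX.
  move: iG; rewrite integral_mkcond; apply: le_lt_trans.
  rewrite le_eqVlt; apply/orP; left; apply/eqP; apply: eq_integral => x _.
  rewrite patchE gee0_abs ?lee_fin ?sqr_ge0// Normc.normcM normc_cutoff indicE.
  by case: ifP => _; rewrite ?mul1r// mul0r expr0n.
apply: (@le_cintegrable _ _ _ _ _ (fun x : measurableTypeR R =>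
  \1_`[0, r] x + nc (cutoff `[0, r] x * G x) ^+ 2) mG) => [|x].
  exact: (integrableD measurableT ii i2).
rewrite Normc.normcM normc_cutoff indicE.
have g (t : R) : t <= 1 + t ^+ 2 by have := sqr_ge0 (t - 1); have := sqr_ge0 t; nra.
by case: (_ \in _); rewrite ?mul1r ?mul0r ?expr0n ?addr0.
Qed.

(* When there is no preimage, resp. no Fourier transform, [xget] returns 0;
   the kernel [Gamma_r (., 0)] then vanishes almost everywhere on [0, r]. *)
Lemma krein_Gamma0_P (w : R -> R) (r : R) :
  krein_Gamma0 w r = cst 0 \/
  is_krein_preimage w r (krein_H w) (krein_Gamma0 w r).
Proof. by rewrite /krein_Gamma0; case: xgetP => [G _|]; [right|left]. Qed.

Lemma krein_H_P (w : R -> R) :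
  exists2 F : R -> R[i], F = cst 0 \/ is_fourier_L1L2 (fun l => w l - 1) F
    & krein_H w = fun x => Complex (2 * pi)^-1 0 * F x.
Proof.
exists (xget (cst 0) [set F | is_fourier_L1L2 (fun l => w l - 1) F]) => //.
by case: xgetP => [F _|]; [right|left].
Qed.

Lemma cutoff_Gamma0_integrable (w : R -> R) (r : R) :
  cintegrable mu (fun x => cutoff `[0, r] x * krein_Gamma0 w r x).
Proof.
have [->|[/in_L2_segment_integrable//]] := krein_Gamma0_P w r.
under eq_fun do rewrite mulr0.
by split => /=; exact: integrable0.
Qed.

Lemma cint0 d (T : measurableType d) (m : {measure set T -> \bar R}) :
  cint m (fun=> 0) = 0.
Proof. by rewrite /cint /Rintegral/= integral0. Qed.

(** Replacing t by r - t makes the argument of the kernel the integration variable and pulls out the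
    unimodular factor [expi (l * r)]. *)
Lemma krein_P_ghat (w : R -> R) (r l : R) : krein_P r l w - expi (l * r) =
  - (ghat (fun x => cutoff `[0, r] x * krein_Gamma0 w r x) l * expi (l * r)).
Proof.
have iG := cutoff_Gamma0_integrable w r.
set G := (fun x => cutoff _ x * _ x) in iG *.
have me (f : R -> R) : @measurable_fun _ _ (measurableTypeR R) _ setT f ->
  cmeasurableR (fun x => expi (f x)) by move=> mf; exact: cmeasurable_expi.
rewrite /krein_P addrAC subrr add0r; congr (- _).
rewrite /ghat -cintZr; last first.
  apply: cintegrableMexpi => //; apply: me.
  by apply: measurableT_comp.
rewrite Cintegral_cint -[RHS](cint_reflection r); last first.
  apply: cmeasurableM; last exact: cmeasurable_cst.
  apply: cmeasurableM; first exact: cintegrable_cmeasurable iG.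
  by apply: me; apply: measurableT_comp.
congr cint; apply/funext => t; rewrite /G.
have -> : cutoff `[0, r] (r - t) = cutoff `[0, r] t.
  rewrite /cutoff !indicE; congr (Complex (_ : bool)%:R _).
  apply/idP/idP; rewrite !inE/= !in_itv/= => /andP[? ?]; apply/andP; split; lra.
rewrite -!mulrA -expiD; congr (_ * (_ * expi _)); ring.
Qed.

Lemma krein_P_measurable (w : R -> R) (r : R) :
  cmeasurableR (fun l => krein_P r l w - expi (l * r)).
Proof.
under eq_fun do rewrite krein_P_ghat.
apply: cmeasurableN; apply: cmeasurableM.
  exact: (cmeasurable_ghat (cutoff_Gamma0_integrable w r)).
by apply: cmeasurable_expi; exact: measurable_funM.
Qed.

Lemma krein_P_bounded (w : R -> R) (r : R) :
  exists M : R, forall l, nc (krein_P r l w - expi (l * r)) <= M.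
Proof.
have iG := cutoff_Gamma0_integrable w r.
eexists => l; rewrite krein_P_ghat normcN Normc.normcM normc_expi mulr1.
exact: (normc_ghat_le_fine iG).
Qed.

Lemma krein_P_le (w : R -> R) (r : R) : 0 < r -> measurable_fun setT w ->
  exists2 C : R, 0 <= C & forall l : R,
    ((nc (krein_P r l w - expi (l * r)))%:E <=
      C%:E * \int[mu]_x (`|w x - 1| * decay (x - l))%:E)%E.
Proof.
move=> r0 mw.
have iG := cutoff_Gamma0_integrable w r.
have nE l : nc (krein_P r l w - expi (l * r)) =
    nc (ghat (fun x => cutoff `[0, r] x * krein_Gamma0 w r x) l).
  by rewrite krein_P_ghat normcN Normc.normcM normc_expi mulr1.
suff : (forall l, ghat (fun x => cutoff `[0, r] x * krein_Gamma0 w r x) l = 0) \/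
    exists2 C : R, 0 <= C & forall l : R,
    ((nc (ghat (fun x => cutoff `[0, r] x * krein_Gamma0 w r x) l))%:E <=
      C%:E * \int[mu]_x (`|w x - 1| * decay (x - l))%:E)%E.
  case=> [g0|[C C0 le]].
    by exists 0 => // l; rewrite nE g0 Normc.normc0 mul0e.
  by exists C => // l; rewrite nE.
have [G0|[_ eqG]] := krein_Gamma0_P w r.
  left => l; rewrite G0 /ghat -[RHS](cint0 mu).
  by congr cint; apply/funext => x; rewrite mulr0 mul0r.
have [F FP HE] := krein_H_P w.
have suppG x : ~ `[0, r]%classic x -> cutoff `[0, r] x * krein_Gamma0 w r x = 0.
  by move=> xr; rewrite cutoffF// mul0r.
(* The preimage equation concerns [0, r] only; the cutoffs extend the kernel by zero and make the
   equation an identity on the line. *)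
have eqG' : {ae mu, forall s,
    cutoff `[0, r] s * (cutoff `[0, r] s * krein_Gamma0 w r s) + cutoff `[0, r] s *
     cint mu (fun y => Complex (2 * pi)^-1 0 * F (s - y) *
       (cutoff `[0, r] y * krein_Gamma0 w r y)) =
     cutoff `[0, r] s * (Complex (2 * pi)^-1 0 * F s)}.
  apply: (ae_mono _ eqG) => s eqs.
  have [sr|sr] := pselect (`[0, r]%classic s); last first.
    by rewrite cutoffF// !mul0r addr0.
  rewrite cutoffT// !mul1r; move: eqs; rewrite inE/= => /(_ sr).
  rewrite /krein_op Cintegral_cint HE => <-; congr (_ + cint _ _).
  by apply/funext => y; ring.
(* If the accelerant is the default 0, the convolution drops out and the equation leaves a kernel
   with zero transform. *)
case: FP => [F0|uF].
  left => l; rewrite /ghat -[RHS](cint0 mu).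
  apply: ae_eq_cint.
  - apply: cmeasurableM; first exact: cintegrable_cmeasurable iG.
    by apply: cmeasurable_expi; apply: measurableT_comp.
  - exact: cmeasurable_cst.
  apply: (ae_mono _ eqG') => s.
  rewrite F0 /= !mulr0 [X in cint _ X](_ : _ = (fun=> 0)); last first.
    by apply/funext => y; rewrite mul0r.
  rewrite cint0 mulr0 addr0 => eqs.
  have [sr|sr] := pselect (`[0, r]%classic s); last by rewrite suppG// mul0r.
  by move: eqs; rewrite {1}cutoffT// mul1r => ->; rewrite mul0r.
right; apply: (ghat_krein_le uF r0 _ iG suppG eqG').
exact: measurable_funB.
Qed.

End KreinP.

(** * From the convolution bound to weighted L^p *)

Section Main.
Context {R : realType}.
Local Notation mu := (@lebesgue_measure R).

(** Since 1/q lies between 1/q2 and 1, v^(1/q) is at most v when v >= 1 and at most v^(1/q2) when v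
    < 1. In this way both summands of w - 1 are expressed through one function v and two fixed
    exponents. *)
Lemma le_sum_powR (q q2 a v : R) : 1 <= q <= q2 -> 0 <= a -> a `^ q <= v ->
  a <= v + v `^ q2^-1.
Proof.
move=> /andP[q1 qq2] a0 av.
have q0 : 0 < q by lra.
have q20 : 0 < q2 by lra.
have v0 : 0 <= v by apply: le_trans av; exact: powR_ge0.
have aE : a = (a `^ q) `^ q^-1 by rewrite -powRrM divff ?gt_eqF// powRr1.
have : a <= v `^ q^-1.
  rewrite [leLHS]aE; apply: ge0_ler_powR; rewrite ?nnegrE ?powR_ge0//.
  by rewrite invr_ge0 ltW.
move=> /le_trans; apply.
have vp := powR_ge0 v q2^-1.
have [v1|v1] := leP 1 v.
  apply: (@le_trans _ _ v); last by lra.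
  by rewrite -[leRHS]powRr1//; apply: ler_powR => //; rewrite invf_le1.
move: v0; rewrite le_eqVlt => /predU1P[<-|v0].
  by rewrite powR0 ?invr_eq0 ?gt_eqF// add0r powR_ge0.
apply: (@le_trans _ _ (v `^ q2^-1)); last by lra.
apply: ger_powR; first by rewrite v0 ltW.
by rewrite lef_pV2.
Qed.

Lemma le_1powR (q a : R) : 1 <= q -> 0 <= a -> a <= 1 + a `^ q.
Proof.
move=> q1 a0; have ap := powR_ge0 a q.
have [a1|a1] := leP a 1; first lra.
have : a <= a `^ q by apply: le1r_powR => //; exact: ltW.
lra.
Qed.

Lemma powR_le_bounded (x M p q : R) : 0 < q -> q <= p -> 0 <= x <= M ->
  x `^ p <= M `^ (p - q) * x `^ q.
Proof.
move=> q0 qp /andP[]; rewrite le_eqVlt => /predU1P[<- _|x0 xM].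
  by rewrite powR0 ?gt_eqF//; [rewrite mulr_ge0 ?powR_ge0|lra].
rewrite -[in leLHS](subrK q p) (@powRD _ x (p - q) q); last first.
  by rewrite (gt_eqF x0) implybT.
apply: ler_wpM2r; first exact: powR_ge0.
by apply: ge0_ler_powR; rewrite ?nnegrE ?subr_ge0 ?(ltW x0)//; lra.
Qed.

Lemma krein_P_in_Lp (w : R -> R) (p1 p2 p q r : R) :
  1 <= p1 <= p2 -> p2 < p -> 1 < p -> p <= q -> weight w ->
  in_Lp_sum p1 p2 (fun l => w l - 1) -> 0 < r ->
  in_Lp_weighted q w (fun l => krein_P r l w - expi (l * r)).
Proof.
move=> p12 p2p p_gt1 pq [mw w0] [f1 [f2 [f1p f2p wE]]] r0.
have /andP[p11 p1p2] := p12.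
have p21 : 1 <= p2 by exact: le_trans p1p2.
have p20 : 0 < p2 by lra.
have mg := krein_P_measurable w r.
set g := (fun l : R => krein_P r l w - expi (l * r)) in mg *.
split; first exact: mg.
have mn := cmeasurable_normc mg.
have i1 := Lfun_integrable p11 f1p.
have i2 := Lfun_integrable p21 f2p.
(* A single integrable function controls both w - 1, through two of its powers, and the weight
   itself. *)
pose v x := `|f1 x| `^ p1 + `|f2 x| `^ p2.
have v0 x : 0 <= v x by rewrite addr_ge0 ?powR_ge0.
have iv : mu.-integrable setT (fun x => (v x)%:E).
  exact: (integrableD measurableT i1 i2).
have mv : @measurable_fun _ _ (measurableTypeR R) _ setT v.
  by move/measurable_int/measurable_EFinP : iv.
have le1 x : `|w x - 1| <= 2 * (v x `^ 1 + v x `^ p2^-1).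
  rewrite wE powRr1//; apply: (le_trans (ler_normD _ _)).
  have A1 : `|f1 x| `^ p1 <= v x by rewrite lerDl powR_ge0.
  have A2 : `|f2 x| `^ p2 <= v x by rewrite lerDr powR_ge0.
  have := le_sum_powR p12 (normr_ge0 _) A1.
  have p22 : 1 <= p2 <= p2 by rewrite p21 lexx.
  have := le_sum_powR p22 (normr_ge0 _) A2.
  lra.
(* One unit comes from w = 1 + (w - 1), and one from [le_1powR] for each summand. *)
have le2 x : w x <= 3 + v x.
  have : w x <= 1 + `|f1 x| + `|f2 x|.
    rewrite -(subrK 1 (w x)) wE.
    have := ler_norm (f1 x); have := ler_norm (f2 x); lra.
  have := le_1powR p11 (normr_ge0 (f1 x)).
  have := le_1powR p21 (normr_ge0 (f2 x)).
  rewrite /v; lra.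
have pV1 : p^-1 < 1 by rewrite invf_lt1//; lra.
(* The exponents theta = 1 and theta = 1/p2 handle the two powers of v; the second uses p > p2. *)
have th1 : p^-1 < 1 <= (1 : R) by rewrite pV1 lexx.
have th2 : p^-1 < p2^-1 <= 1.
  by rewrite invf_le1// p21 andbT ltf_pV2// posrE; lra.
have [A1 [C1 [A10 iA1 C10 leA1]]] := young_decay p_gt1 th1 v0 iv.
have [A2 [C2 [A20 iA2 C20 leA2]]] := young_decay p_gt1 th2 v0 iv.
have [C C0 leC] := krein_P_le r0 mw.
have [M leM] := krein_P_bounded w r.
have M0 : 0 <= M by apply: le_trans (leM 0); exact: normc_ge0.
have md (l : R) : @measurable_fun _ _ (measurableTypeR R) _ setT (fun x : R => decay (x - l)).
  apply: (@measurableT_comp _ _ _ _ _ _ (@decay R)).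
    by apply: continuous_measurable_fun; exact: continuous_decay.
  exact: measurable_funB.
have dge0 (x : R) : 0 <= decay x by rewrite ltW// decay_gt0.
pose K := 2 * C * (C1 + C2).
have K0 : 0 <= K by rewrite /K mulr_ge0// ?addr_ge0// mulr_ge0.
have leg l : nc (g l) <= K * (A1 l + A2 l) `^ p^-1.
  have mvp (t : R) : measurable_fun setT
      (fun x : measurableTypeR R => (v x `^ t * decay (x - l))%:E).
    apply/measurable_EFinP; apply: measurable_funM => //.
    exact: (measurableT_comp (measurable_powR _)).
  have vp0 (t x : R) : (0%:E <= (v x `^ t * decay (x - l))%:E)%E.
    by rewrite lee_fin mulr_ge0 ?powR_ge0.
  rewrite -lee_fin; apply: (le_trans (leC l)).
  apply: (@le_trans _ _ (C%:E * (2%:E * (\int[mu]_x (v x `^ 1 * decay (x - l))%:E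
      + \int[mu]_x (v x `^ p2^-1 * decay (x - l))%:E)))%E).
    apply: lee_wpmul2l => //.
    rewrite -ge0_integralD// -ge0_integralZl//; last 2 first.
    - exact: emeasurable_funD.
    - by move=> x _; exact: adde_ge0.
    apply: ge0_le_integral => //.
    - by move=> x _; rewrite lee_fin mulr_ge0.
    - apply/measurable_EFinP; apply: measurable_funM => //.
      by apply: measurableT_comp => //; exact: measurable_funB.
    - by apply: emeasurable_funM => //; exact: emeasurable_funD.
    move=> x _.
    rewrite [leRHS](_ : _ = (2 * (v x `^ 1 * decay (x - l) + v x `^ p2^-1 * decay (x - l)))%:E)//.
    rewrite lee_fin -mulrDl mulrA; apply: ler_wpM2r => //.
  apply: (@le_trans _ _ (C%:E * (2%:E * ((C1 * A1 l `^ p^-1)%:E + (C2 * A2 l `^ p^-1)%:E)))%E).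
    by apply: lee_wpmul2l => //; apply: lee_wpmul2l => //; exact: leeD.
  rewrite [leLHS](_ : _ = (C * (2 * (C1 * A1 l `^ p^-1 + C2 * A2 l `^ p^-1)))%:E)//.
  rewrite lee_fin.
  have ip0 : 0 <= p^-1 by rewrite invr_ge0; lra.
  have B1 : A1 l `^ p^-1 <= (A1 l + A2 l) `^ p^-1.
    by apply: ge0_ler_powR; rewrite ?nnegrE ?addr_ge0 ?lerDl.
  have B2 : A2 l `^ p^-1 <= (A1 l + A2 l) `^ p^-1.
    by apply: ge0_ler_powR; rewrite ?nnegrE ?addr_ge0 ?lerDr.
  rewrite /K; set X := (A1 l + A2 l) `^ p^-1 in B1 B2 *.
  have -> : 2 * C * (C1 + C2) * X = C * (2 * (C1 * X + C2 * X)) by ring.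
  apply: ler_wpM2l => //; apply: ler_wpM2l => //.
  by apply: lerD; apply: ler_wpM2l.
have p0 : 0 < p by lra.
have legp l : nc (g l) `^ p <= K `^ p * (A1 l + A2 l).
  apply: (@le_trans _ _ ((K * (A1 l + A2 l) `^ p^-1) `^ p)).
    apply: ge0_ler_powR; [exact: ltW| | |exact: leg].
      by rewrite nnegrE normc_ge0.
    by rewrite nnegrE; apply: mulr_ge0 => //; exact: powR_ge0.
  by rewrite powRM ?powR_ge0// -powRrM mulVf ?gt_eqF// powRr1 ?addr_ge0.
pose N := M `^ (q - p).
have N0 : 0 <= N by exact: powR_ge0.
(* [N] lowers the exponent from q to p by boundedness. Against the constant 3 of the weight, the
   Young bound [legp] is used; against its part v, the sup bound M^p. *)
pose T l := N * (3 * K `^ p * (A1 l + A2 l) + M `^ p * v l).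
have iT : mu.-integrable setT (fun l => (T l)%:E).
  have iA := integrableD measurableT iA1 iA2.
  have j1 := integrableZl measurableT (3 * K `^ p) iA.
  have j2 := integrableZl measurableT (M `^ p) iv.
  exact: (integrableZl measurableT N (integrableD measurableT j1 j2)).
apply: le_lt_trans (integrable_lty measurableT iT).
apply: ge0_le_integral => //.
- by move=> l _; rewrite lee_fin mulr_ge0 ?powR_ge0.
- apply/measurable_EFinP; apply: measurable_funM => //.
  exact: (measurableT_comp (measurable_powR _)).
- exact: measurable_int iT.
move=> l _; rewrite lee_fin /T.
apply: (@le_trans _ _ (N * nc (g l) `^ p * (3 + v l))).
  apply: ler_pM; rewrite ?powR_ge0//.
  by apply: powR_le_bounded => //; rewrite normc_ge0 leM.
rewrite -mulrA; apply: ler_wpM2l => //; rewrite mulrDr; apply: lerD.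
  by rewrite mulrC -mulrA; apply: ler_wpM2l.
apply: ler_wpM2r => //.
by apply: ge0_ler_powR; rewrite ?nnegrE ?normc_ge0 ?(ltW p0)//; exact: leM.
Qed.

End Main.

Unset Implicit Arguments.

Theorem mainTheorem3 (R : realType) (gamma p2 : R)
    (hgamma : 1 <= gamma) (hp2 : 1 <= p2 < 2) :
  exists delta : R, 0 < delta /\
    forall (p1 : R) (w : R -> R),
      1 <= p1 <= p2 ->
      weight w ->
      in_Lp_sum p1 p2 (fun l => w l - 1) ->
      (A2_characteristic w <= gamma%:E)%E ->
      forall r p : R, 0 < r -> 2 - delta <= p ->
        in_Lp_weighted p w (fun l => krein_P r l w - expi (l * r)).
Proof.
move: hp2 => /andP[p21 p2lt2].
(* This makes 2 - delta = 1 + p2 / 2, the midpoint of p2 and 2: strictly above p2 because p2 < 2,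
   and above 1. *)
exists (1 - p2 / 2); split; first lra.
move=> p1 w p12 ww uw _ r p r0 hp.
have e1 : p2 < 1 + p2 / 2 by lra.
have e2 : 1 < 1 + p2 / 2 by lra.
apply: (krein_P_in_Lp p12 e1 e2 _ ww uw r0).
lra.
Qed.
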